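(* Let $n\ge 2$. An element $w\in B_n$ satisfies $|O_{\mathrm{Pop}_T}(w)|=2n-1$ if and only if $w$ is $B$-splittable. In particular, the number of $w\in B_n$ with $|O_{\mathrm{Pop}_T}(w)|=2n-1$ is $2^n-n-1$.
   Context: Write $\bar i$ for $-i$ and $\pm[n]=\{1,\dots,n,\bar1,\dots,\bar n\}$. The hyperoctahedral group $B_n$ is the group of permutations $w$ of $\pm[n]$ with $w(\bar i)=\overline{w(i)}$ for all $i$; permutations are composed right-to-left. Its set of reflections $T$ consists of the elements $(i\ j)(\bar i\ \bar j)$ for $i,j\in\pm[n]$ with $j\notin\{i,\bar i\}$, and $(i\ \bar i)$ for $i\in[n]$. $\ell_T(w)$ is the minimal number of reflections with product $w$, and $u\le_T v$ iff $\ell_T(u)+\ell_T(u^{-1}v)=\ell_T(v)$. Fix $c=(\bar1\ \bar2\ \cdots\ \bar n\ 1\ 2\ \cdots\ n)$ and let $NC(B_n,c)=\{w:e\le_T w\le_T c\}$, a lattice under $\le_T$. Define $\pi_T(w)=\bigvee_{t\in T,\ t\le_T w}t$ (join in $NC(B_n,c)$), $\mathrm{Pop}_T(w)=w\cdot\pi_T(w)^{-1}$, and $O_{\mathrm{Pop}_T}(w)=\{w,\mathrm{Pop}_T(w),\mathrm{Pop}_T^2(w),\dots\}$. Totally order $\pm[n]$ by $\bar1\prec\bar2\prec\cdots\prec\bar n\prec1\prec2\prec\cdots\prec n$. An antiexceedance of $w\in B_n$ is an $i\in\pm[n]$ with $i\prec w^{-1}(i)$. $\mathrm{cyc}(u)$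 is the number of cycles of $u$ of length greater than $1$. $w\in B_n$ is $B$-splittable if it has exactly $2n-2$ antiexceedances and $\mathrm{cyc}(\pi_T(w))=1$. *)

(* Defs.v *)
From mathcomp Require Import all_boot all_order all_fingroup.

Set Implicit Arguments.
Unset Strict Implicit.
Unset Printing Implicit Defensive.

Local Open Scope group_scope.

(* Encoding of +-[n] = {bar1,...,bar n,1,...,n} as 'I_(2n):
   k < n encodes bar(k+1), and n <= k < 2n encodes (k-n+1).
   The total order  bar1 < ... < bar n < 1 < ... < n  is then the natural
   order on ordinals, and i |-> bar i is k |-> (k + n) mod 2n. *)
Notation pm n := ('I_(n.*2)).

Definition negI n (i : pm n) : pm n :=
  Ordinal (ltn_pmod (i + n) (leq_ltn_trans (leq0n i) (ltn_ord i))).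

(* right-to-left composition: (comp u v) x = u (v x) *)
Definition comp n (u v : {perm pm n}) : {perm pm n} := v * u.

Definition Bn n : {set {perm pm n}} :=
  [set w : {perm pm n} | [forall i : pm n, w (negI i) == negI (w i)]].

Definition reflB n : {set {perm pm n}} :=
  [set t : {perm pm n} |
     [exists i : pm n, exists j : pm n,
        [&& j != i, j != negI i &
            t == comp (tperm i j) (tperm (negI i) (negI j))]]
     || [exists i : pm n, (n <= i) && (t == tperm i (negI i))]].

Definition Tfact n (w : {perm pm n}) (k : nat) : bool :=
  [exists s : k.-tuple {perm pm n},
     all (fun t => t \in reflB n) s &&
     (foldr (@comp n) 1 s == w)].

(* reflection length: the least k such that w is a product of k reflections.
   A minimal word for an element of the group generated by T has length
   < #|{perm pm n}|, so searching k in [0, #|{perm pm n}|] is exhaustive. *)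
Definition ellT n (w : {perm pm n}) : nat :=
  find (Tfact w) (iota 0 #|{perm pm n}|.+1).

Definition leT n (u v : {perm pm n}) : bool :=
  ellT u + ellT (comp u^-1 v) == ellT v.

(* the Coxeter element c = (bar1 bar2 ... bar n 1 2 ... n) *)
Definition coxc n : {perm pm n} := perm (@ordS_inj (n.*2)).

Definition NCB n : {set {perm pm n}} :=
  [set w in Bn n | leT 1 w && leT w (coxc n)].

Definition NCjoin n (S : {set {perm pm n}}) : {perm pm n} :=
  odflt 1 [pick u in NCB n |
     [forall s in S, leT s u] &&
     [forall v in NCB n, [forall s in S, leT s v] ==> leT u v]].

Definition piT n (w : {perm pm n}) : {perm pm n} :=
  NCjoin [set t in reflB n | leT t w].

Definition PopT n (w : {perm pm n}) : {perm pm n} := comp w (piT w)^-1.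

Definition orbit_size n (w : {perm pm n}) : nat := #|fconnect (@PopT n) w|.

Definition antiexc n (w : {perm pm n}) : {set pm n} :=
  [set i : pm n | i < w^-1 i].

Definition cyc n (u : {perm pm n}) : nat :=
  #|[set C in porbits u | (1 < #|C|)%N]|.

Definition Bsplittable n (w : {perm pm n}) : bool :=
  [&& w \in Bn n, #|antiexc w| == (n.*2 - 2) & cyc (piT w) == 1%N].

(* Main.v *)
Require Import Defs.
From mathcomp Require Import all_boot all_order all_fingroup.
From mathcomp Require Import all_algebra zify ring lra.
(* Imported again because [ssrfun.comp] shadows [Defs.comp]. *)
Import Defs.

(** Over the rationals, [w] acts on the antisymmetric functions on [+-[n]], and
    its reflection length is the codimension of its fixed space. As [c] has no
    nonzero fixed vector, the argument of Brady and Watt shows that on [[1, c]]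
    the absolute order is reverse inclusion of fixed spaces, and the functions
    that agree on [i |-> v^-1 i] and [i |-> c^-1 i] for [v <= c] force the blocks
    of [v] not to cross. Hence [piT w] rotates the blocks of the noncrossing
    closure of the cycles of [w].

    Let [a] count the [x] with [w x < x]. One step of Pop lowers [a] by the number
    of nontrivial cycles of [piT w], so an orbit has at most [a + 1 <= 2n]
    elements; [a = 2n - 1] only for [c^-1], whose orbit has size [2n]. So orbits of
    size [2n - 1] need [a = 2n - 2] and one nontrivial cycle at each step.

    If [a = 2n - 2] then [w = succ_S^-1 c^(2n-1)], where [succ_S] is the cyclic
    successor in a symmetric set [S] with at least two elements. If [#|S| = 2],
    [w] preserves two opposite half-circles. If [#|S| > 2], all iterates are of the
    form [succ_S^-1 succ_V^L]: a step lowers [L] by one, and when a gap of [S] in [V]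
    has length [L] its starting point is a fixed point, which is removed from [V]
    while the rest of the gap is filled with points of [S]; connectedness of the
    closure is checked on a class that is an arc of [V]. Such an orbit has exactly
    [L] elements, and there are [2^n - n - 1] symmetric sets [S] with [#|S| > 2]. *)

Set Implicit Arguments.
Unset Strict Implicit.
Unset Printing Implicit Defensive.
Import GRing.Theory Num.Theory.

(** * Signed permutations and reflections *)

Section Basic.
Variable n : nat.
Notation pmn := (pm n).
Implicit Types (i j k l x y z : pmn) (u v w : {perm pmn}).

(** Addition modulo [2n] is unfolded into two linear cases that [lia] can use; [coxc_val],
    [coxcV_val] and [cdist_spec] have this form for the same purpose. *)
Lemma negI_val i :
  ((i < n)%N /\ negI i = (i + n)%N :> nat) \/ ((n <= i)%N /\ (negI i + n)%N = i).
Proof.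
rewrite /negI /=; have := ltn_ord i; case: (ltnP i n) => hi hN.
  by left; split=> //; rewrite modn_small //; lia.
right; split=> //; have -> : (i + n)%N = (i - n + n.*2)%N by lia.
by rewrite modnDr modn_small; lia.
Qed.

Lemma negIK : involutive (@negI n).
Proof.
move=> i; apply: ord_inj; have := negI_val (negI i); have := negI_val i.
have := ltn_ord i; lia.
Qed.

Lemma negI_neq i : negI i != i.
Proof.
by apply/eqP=> /(congr1 (@nat_of_ord _)); have := negI_val i; have := ltn_ord i; lia.
Qed.

Definition negperm : {perm pmn} := perm (inv_inj negIK).

Lemma compE u v i : comp u v i = u (v i).
Proof. by rewrite /comp permM. Qed.

Lemma BnP w : reflect (forall i, w (negI i) = negI (w i)) (w \in Bn n).
Proof. by rewrite inE; apply: (iffP forallP) => h i; apply/eqP. Qed.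

Lemma Bn1 : 1%g \in Bn n. Proof. by apply/BnP => i; rewrite !perm1. Qed.

Lemma BnM u v : u \in Bn n -> v \in Bn n -> comp u v \in Bn n.
Proof. by move=> /BnP hu /BnP hv; apply/BnP=> i; rewrite !compE hv hu. Qed.

Lemma BnV u : u \in Bn n -> (u^-1)%g \in Bn n.
Proof.
by move=> /BnP hu; apply/BnP=> i; apply: (@perm_inj _ u); rewrite permKV hu permKV.
Qed.

Lemma coxc_val i :
  ((i.+1 < n.*2)%N /\ coxc n i = i.+1 :> nat) \/ (i.+1 = n.*2 /\ coxc n i = 0%N :> nat).
Proof.
rewrite /coxc permE /ordS /=; have := ltn_ord i; rewrite leq_eqVlt => /orP[/eqP h|h].
  by right; rewrite h modnn.
by left; rewrite modn_small.
Qed.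

Lemma Bn_coxc : coxc n \in Bn n.
Proof.
apply/BnP=> i; apply: ord_inj.
have := negI_val i; have := negI_val (coxc n i); have := coxc_val i.
have := coxc_val (negI i); have := ltn_ord i; lia.
Qed.

(** Covers both kinds of reflection under the single condition [j != i]. The case [j == negI i] is
    separate because the product of the two transpositions would then be the identity. *)
Definition refl_of i j : {perm pmn} :=
  if j == negI i then tperm i j else comp (tperm i j) (tperm (negI i) (negI j)).

Lemma refl_ofP t :
  reflect (exists i j, j != i /\ t = refl_of i j) (t \in reflB n).
Proof.
rewrite inE; apply: (iffP orP) => [[/existsP[i /existsP[j /and3P[h1 h2 /eqP->]]]|]|].
- by exists i, j; rewrite /refl_of (negPf h2).
- case/existsP=> i /andP[_ /eqP->]; exists i, (negI i).
  by rewrite /refl_of eqxx negI_neq.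
case=> i [j [hij ->]]; rewrite /refl_of; case: eqP => [->|/eqP hj]; last first.
  by left; apply/existsP; exists i; apply/existsP; exists j; rewrite hij hj eqxx.
right; apply/existsP; have := negI_val i; have hi := ltn_ord i => h.
case: (leqP n i) => hin; first by exists i; rewrite hin eqxx.
by exists (negI i); rewrite negIK tpermC eqxx andbT; lia.
Qed.

Lemma refl_ofE i j k : j != i ->
  refl_of i j k = if k == i then j else if k == j then i else
                  if k == negI i then negI j else if k == negI j then negI i else k.
Proof.
move=> hij; rewrite /refl_of.
case: (eqVneq j (negI i)) => [->|/eqP hj].
  by rewrite negIK permE /=; do 2!case: eqP => //.
have /eqP h0 := hij; have /eqP h1 := negI_neq i; have /eqP h2 := negI_neq j.
have h3 := negIK i; have h4 := negIK j.
rewrite compE !permE /=; 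
by case: (k =P i) => ?; case: (k =P j) => ?; case: (k =P negI i) => ?;
  case: (k =P negI j) => ?; do ?(case: eqP => ? //=); congruence.
Qed.

Lemma refl_ofK i j : j != i -> comp (refl_of i j) (refl_of i j) = 1%g.
Proof.
move=> hij; apply/permP=> k; rewrite compE perm1 !refl_ofE //.
have /eqP h0 := hij; have /eqP h1 := negI_neq i; have /eqP h2 := negI_neq j.
have h3 := negIK i; have h4 := negIK j.
by case: (k =P i) => ?; case: (k =P j) => ?; case: (k =P negI i) => ?;
  case: (k =P negI j) => ?; do ?(case: eqP => ? //=); congruence.
Qed.

Lemma Bn_refl_of i j : j != i -> refl_of i j \in Bn n.
Proof.
move=> hij; apply/BnP=> k; rewrite !refl_ofE //.
have /eqP h0 := hij; have /eqP h1 := negI_neq i; have /eqP h2 := negI_neq j.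
have h3 := negIK i; have h4 := negIK j; have h5 := negIK k.
by case: (k =P i) => ?; case: (k =P j) => ?; case: (k =P negI i) => ?;
  case: (k =P negI j) => ?; do ?(case: eqP => ? //=); congruence.
Qed.

End Basic.

(** * Reflection length as a codimension *)

Section Linear.
Local Open Scope ring_scope.
Variable n : nat.
Notation pmn := (pm n).
Notation vT := 'rV[rat]_(n.*2).
Implicit Types (i j k l : pmn) (u v w t : {perm pmn}) (x y f : vT).

Definition pullback w : 'End(vT) := linfun (col_perm w).

Lemma pullbackE w x i : pullback w x 0 i = x 0 (w i).
Proof. by rewrite lfunE mxE. Qed.

Definition antisym : {vspace vT} := lker (pullback (negperm n) + \1)%VF.
(** The fixed space of [comp u^-1 v] (see [fixspace_comp]), written symmetrically in [u] and [v]. *)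
Definition eqspace u v : {vspace vT} :=
  (antisym :&: lker (pullback u^-1 - pullback v^-1)%VF)%VS.
Definition fixspace w : {vspace vT} := (antisym :&: lker (pullback w - \1)%VF)%VS.

Lemma antisymP x : reflect (forall i, x 0 (negI i) = - x 0 i) (x \in antisym).
Proof.
rewrite memv_ker add_lfunE id_lfunE addr_eq0; apply: (iffP eqP) => [h i|h].
  by move/rowP/(_ i): h; rewrite pullbackE mxE permE.
by apply/rowP=> i; rewrite pullbackE permE mxE h.
Qed.

Lemma fixspaceP w x :
  reflect (x \in antisym /\ forall i, x 0 (w i) = x 0 i) (x \in fixspace w).
Proof.
apply: (iffP memv_capP); rewrite memv_ker add_lfunE opp_lfunE id_lfunE subr_eq0.
  by move=> [h /eqP e]; split=> // i; rewrite -pullbackE e.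
by move=> [h e]; split=> //; apply/eqP/rowP=> i; rewrite pullbackE e.
Qed.

Lemma eqspaceP u v x :
  reflect (x \in antisym /\ forall i, x 0 ((u^-1)%g i) = x 0 ((v^-1)%g i)) (x \in eqspace u v).
Proof.
apply: (iffP memv_capP); rewrite memv_ker add_lfunE opp_lfunE subr_eq0.
  by move=> [h /eqP e]; split=> // i; rewrite -!pullbackE e.
by move=> [h e]; split=> //; apply/eqP/rowP=> i; rewrite !pullbackE e.
Qed.

Lemma fixspace_comp u v : fixspace (comp (u^-1)%g v) = eqspace u v.
Proof.
apply/vspaceP=> x; apply/fixspaceP/eqspaceP=> -[hx h]; split=> // i.
  by have := h ((v^-1)%g i); rewrite compE permKV.
by rewrite compE h permK.
Qed.

Lemma fixspace1 : fixspace 1%g = antisym.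
Proof.
by apply/vspaceP=> x; apply/fixspaceP/idP=> [[]//|hx]; split=> // i; rewrite perm1.
Qed.

(** On [antisym] this is the mirror of [refl_of i j]; for [j = negI i] the equation says that the
    coordinate at [i] vanishes. *)
Definition evspace i j : {vspace vT} := lker (linfun (col i) - linfun (col j))%VF.

Lemma evspaceP i j x : reflect (x 0 i = x 0 j) (x \in evspace i j).
Proof.
rewrite memv_ker add_lfunE opp_lfunE subr_eq0 !lfunE /=.
apply: (iffP eqP) => [/matrixP/(_ 0 0)|h]; first by rewrite !mxE.
by apply/matrixP=> a b; rewrite !mxE !ord1.
Qed.

Lemma dim_cap_evspace (U : {vspace vT}) i j :
  (\dim U <= (\dim (U :&: evspace i j)%VS).+1)%N.
Proof.
have := limg_ker_dim (linfun (col i) - linfun (col j))%VF U.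
have /dimvS := subvf ((linfun (col i) - linfun (col j))%VF @: U)%VS.
by rewrite dimvf /dim /= -/(evspace i j) muln1 => h <-; rewrite -[(\dim (_ :&: _)).+1]addn1 leq_add2l.
Qed.

Lemma refl_of_fix i j x k : j != i -> x \in antisym -> x 0 i = x 0 j ->
  x 0 (refl_of i j k) = x 0 k.
Proof.
move=> hij /antisymP hx e; rewrite refl_ofE //.
by do 4?[case: eqP => [->|_]]; rewrite ?hx ?e.
Qed.

Lemma fixspace_refl_mul i j w : j != i ->
  (fixspace w :&: evspace i j <= fixspace (comp (refl_of i j) w))%VS.
Proof.
move=> hij; apply/subvP=> x /memv_capP[/fixspaceP[hx hw] /evspaceP e].
by apply/fixspaceP; split=> // k; rewrite compE refl_of_fix.
Qed.

Lemma dim_fixspace_refl_mul i j w : j != i ->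
  (\dim (fixspace w) <= (\dim (fixspace (comp (refl_of i j) w))).+1)%N.
Proof.
move=> hij; apply: leq_trans (dim_cap_evspace _ i j) _.
by rewrite ltnS; apply: dimvS; apply: fixspace_refl_mul.
Qed.

Lemma comp_refl_ofK i j w : j != i -> comp (refl_of i j) (comp (refl_of i j) w) = w.
Proof.
move=> hij; apply/permP=> k; rewrite !compE.
by have /permP/(_ (w k)) := refl_ofK hij; rewrite compE perm1.
Qed.

Definition evec i : vT := delta_mx 0 i - delta_mx 0 (negI i).

Lemma evecE i k : evec i 0 k = (k == i)%:R - (k == negI i)%:R.
Proof. by rewrite !mxE. Qed.

Lemma evec_antisym i : evec i \in antisym.
Proof.
apply/antisymP=> k; rewrite !evecE opprB (inj_eq (inv_inj (@negIK n))).
by rewrite -{1}[i]negIK (inj_eq (inv_inj (@negIK n))).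
Qed.

Lemma fixspace_antisym w : (fixspace w <= antisym)%VS.
Proof. exact: capvSl. Qed.

(** A function fixed by [w] agrees at [i] and [w i], so it stays fixed after the multiplication. The
    point [i] becomes fixed, so [evec i] is a new fixed vector, and one reflection cannot add more
    than one dimension. *)
Lemma dim_fixspace_step w i : w i != i -> w \in Bn n ->
  \dim (fixspace (comp (refl_of i (w i)) w)) = (\dim (fixspace w)).+1.
Proof.
move=> hi /BnP hw; set t := refl_of _ _.
have hb := dim_fixspace_refl_mul (comp t w) hi.
rewrite comp_refl_ofK // -/t in hb; apply/eqP; rewrite eqn_leq hb /=.
have hs : (fixspace w <= fixspace (comp t w))%VS.
  apply: subv_trans (fixspace_refl_mul w hi); rewrite subv_cap subvv /=.
  by apply/subvP=> x /fixspaceP[_ e]; apply/evspaceP.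
rewrite ltn_neqAle (dimvS hs) andbT; apply/negP=> hd.
have {hd} : fixspace w == fixspace (comp t w) by rewrite eqEdim hs -(eqP hd) leqnn.
have hti : comp t w i = i by rewrite compE refl_ofE // (negPf hi) eqxx.
have htn : comp t w (negI i) = negI i.
  have := Bn_refl_of hi => /BnP ht.
  by rewrite compE hw ht -compE hti.
have hx : evec i \in fixspace (comp t w).
  apply/fixspaceP; split; first exact: evec_antisym.
  have he a k : comp t w a = a -> (comp t w k == a) = (k == a).
    by move=> ha; rewrite -[X in _ == X]ha (inj_eq perm_inj).
  by move=> k; rewrite !evecE !he.
move=> /eqP e; move: hx; rewrite -e => /fixspaceP[_ /(_ i)].
rewrite !evecE eqxx (negPf hi) (eq_sym i) (negPf (negI_neq i)).
by case: eqP.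
Qed.

Lemma perm1_of_fix w : w \in Bn n -> \dim (fixspace w) = \dim antisym -> w = 1%g.
Proof.
move=> hw hd; apply/permP=> i; rewrite perm1; apply/eqP; apply/negPn/negP=> hi.
have := dim_fixspace_step hi hw; rewrite hd => h.
by have := dimvS (fixspace_antisym (comp (refl_of i (w i)) w)); rewrite h ltnn.
Qed.

Lemma TfactS t w (k : nat) : t \in reflB n -> Tfact w k -> Tfact (comp t w) k.+1.
Proof.
move=> ht /existsP[s /andP[hs /eqP hw]]; apply/existsP; exists [tuple of t :: s].
by rewrite /= ht hs hw eqxx.
Qed.

Lemma Tfact_dim w (k : nat) : Tfact w k ->
  w \in Bn n /\ (\dim antisym <= k + \dim (fixspace w))%N.
Proof.
case/existsP=> -[s /= /eqP <-] /andP[]; elim: s w => [|t s IHs] w /=.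
  by move=> _ /eqP <-; rewrite Bn1 fixspace1.
case/andP=> /refl_ofP[i [j [hij ->]]] hs /eqP <-.
have [h1 h2] := IHs _ hs (eqxx _); split; first exact: BnM (Bn_refl_of hij) h1.
by apply: leq_trans h2 _; rewrite addSnnS leq_add2l dim_fixspace_refl_mul.
Qed.

(** Greedy factorization: as long as [w] moves some [i], multiplying by [refl_of i (w i)] lowers the
    codimension by one. *)
Lemma dim_Tfact w : w \in Bn n -> Tfact w (\dim antisym - \dim (fixspace w)).
Proof.
move e: (_ - _)%N => k; elim: k w e => [|k IHk] w e hw.
  have -> : w = 1%g.
    apply: perm1_of_fix => //; apply/eqP; rewrite eqn_leq dimvS ?fixspace_antisym //.
    by rewrite -subn_eq0 e.
  by apply/existsP; exists [tuple]; rewrite /= eqxx.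
have [i hi] : exists i, w i != i.
  apply/existsP; apply: contraT; rewrite negb_exists => /forallP h.
  have w1 : w = 1%g by apply/permP=> i; rewrite perm1; apply/eqP/negPn.
  by move: e; rewrite w1 fixspace1 subnn.
suff: Tfact (comp (refl_of i (w i)) (comp (refl_of i (w i)) w)) k.+1.
  by rewrite comp_refl_ofK.
apply: TfactS; first by apply/refl_ofP; exists i, (w i).
apply: IHk; last exact: BnM (Bn_refl_of hi) hw.
by rewrite dim_fixspace_step // subnS e.
Qed.

(** Carter's formula: [dim_Tfact] provides a word of this length and [Tfact_dim] excludes shorter
    ones. *)
Lemma ellTE w : w \in Bn n -> ellT w = (\dim antisym - \dim (fixspace w))%N.
Proof.
move=> hw; set k := (_ - _)%N; have hk := dim_Tfact hw.
(* The search range of [ellT] contains the codimension, which is at most [2n <= (2n)!]. *)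
have hkb : (k < #|{perm pmn}|.+1)%N.
  rewrite ltnS (leq_trans (leq_subr _ _)) //.
  apply: leq_trans (dimvS (subvf _)) _; rewrite dimvf /dim /= mul1n.
  rewrite card_Sn.
  by case: (n.*2) => // m; rewrite factS leq_pmulr // fact_gt0.
apply/eqP; rewrite eqn_leq /ellT; apply/andP; split.
  rewrite leqNgt; apply/negP=> /(before_find 0%N).
  by rewrite nth_iota // add0n -/k hk.
have hh : has (Tfact w) (iota 0 #|{perm pmn}|.+1).
  by apply/hasP; exists k => //; rewrite mem_iota.
have := nth_find 0%N hh; rewrite nth_iota; last by rewrite has_find size_iota in hh.
by rewrite add0n => /Tfact_dim[_ h]; rewrite leq_subLR addnC.
Qed.

Lemma leTE u v : u \in Bn n -> v \in Bn n -> leT u v =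
  (\dim antisym - \dim (fixspace u) + (\dim antisym - \dim (eqspace u v)) ==
   \dim antisym - \dim (fixspace v))%N.
Proof. by move=> hu hv; rewrite /leT !ellTE ?BnM ?BnV // fixspace_comp. Qed.

End Linear.

(** * The absolute order below the Coxeter element *)

(* [lia] is very slow when its atoms are dimensions: abstract them first. *)
Ltac dim_lia :=
  repeat match goal with
  | |- context [@dimv ?K ?T ?U] =>
      let d := fresh "d" in set (d := @dimv K T U) in *; clearbody d
  | H : context [@dimv ?K ?T ?U] |- _ =>
      let d := fresh "d" in set (d := @dimv K T U) in *; clearbody d
  end; lia.

Section BradyWatt.
Local Open Scope ring_scope.
Variable n : nat.
Notation pmn := (pm n).
Notation vT := 'rV[rat]_(n.*2).
Notation c := (coxc n).
Implicit Types (i j k l : pmn) (u v w t : {perm pmn}) (x y f : vT).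

Definition dot x y : rat := \sum_k x 0 k * y 0 k.

Lemma dot_additive x : {morph dot x : y z / y + z}.
Proof. by move=> y z; rewrite /dot -big_split; apply: eq_bigr => k _; rewrite mxE mulrDr. Qed.

Lemma dotC x y : dot x y = dot y x.
Proof. by apply: eq_bigr => k _; rewrite mulrC. Qed.

Lemma dotZ a x y : dot x (a *: y) = a * dot x y.
Proof. by rewrite /dot big_distrr; apply: eq_bigr => k _; rewrite mxE mulrCA. Qed.

Lemma dotB x y z : dot x (y - z) = dot x y - dot x z.
Proof. by rewrite -scaleN1r dot_additive dotZ mulN1r. Qed.

Lemma dot_self0 x : dot x x = 0 -> x = 0.
Proof.
move=> h; apply/rowP=> k; rewrite mxE; apply/eqP; rewrite -sqrf_eq0 expr2.
have h0 i : true -> 0 <= x 0 i * x 0 i by rewrite -expr2 sqr_ge0.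
by have := psumr_eq0P h0 h => /(_ k isT) ->.
Qed.

Lemma dot_pullback w x y : dot (pullback w x) y = dot x (pullback w^-1 y).
Proof.
rewrite /dot (reindex_inj (@perm_inj _ w^-1)) /=; apply: eq_bigr => k _.
by rewrite !pullbackE permKV.
Qed.

Lemma antisym_pullback w x : w \in Bn n -> x \in antisym n -> pullback w x \in antisym n.
Proof.
by move=> /BnP hw /antisymP hx; apply/antisymP => i; rewrite !pullbackE hw hx.
Qed.

(** [c] is transitive, so a fixed function is constant, and an antisymmetric constant is zero. *)
Lemma fixspace_coxc : fixspace c = 0%VS.
Proof.
apply/eqP; rewrite -subv0; apply/subvP=> x /fixspaceP[/antisymP hx hc].
rewrite memv0; apply/eqP/rowP=> i; rewrite mxE.
have hN : (0 < n.*2)%N by have := ltn_ord i; lia.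
have h (m : nat) j : j = m :> nat -> x 0 j = x 0 (Ordinal hN).
  elim: m j => [|m IHm] j hj; first by congr (x 0 _); apply: ord_inj.
  have hm : (m < n.*2)%N by have := ltn_ord j; lia.
  rewrite -(IHm (Ordinal hm)) // -[RHS]hc; congr (x 0 _); apply: ord_inj.
  by have := coxc_val (Ordinal hm); have := ltn_ord j; rewrite /=; lia.
have := hx i; rewrite (h _ (negI i) erefl) (h _ i erefl); lra.
Qed.

Lemma fixspace_mulI u v :
  (fixspace u :&: eqspace u v <= fixspace v)%VS.
Proof.
apply/subvP=> x /memv_capP[/fixspaceP[hx hu] /eqspaceP[_ e]].
apply/fixspaceP; split=> // i; rewrite -[in RHS](permK v i) -e.
by rewrite -[in RHS]hu permKV.
Qed.

(** The two spaces meet inside [fixspace c = 0], so their dimensions never sum to more than that of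
    [antisym]; being below [c] is the case of equality. *)
Lemma dim_leT_coxc u : u \in Bn n ->
  leT u c = (\dim (antisym n) <= \dim (fixspace u) + \dim (eqspace u c))%N.
Proof.
move=> hu; rewrite leTE ?Bn_coxc // fixspace_coxc dimv0.
have h1 : (\dim (fixspace u) <= \dim (antisym n))%N by rewrite dimvS ?capvSl.
have h2 : (\dim (eqspace u c) <= \dim (antisym n))%N by rewrite dimvS ?capvSl.
have h3 : (\dim (fixspace u) + \dim (eqspace u c) <= \dim (antisym n))%N.
  rewrite -dimv_disjoint_sum; last first.
    by apply/eqP; rewrite -subv0 -fixspace_coxc fixspace_mulI.
  by apply: dimvS; rewrite subv_add !capvSl.
by apply/eqP/idP => h; dim_lia.
Qed.

Lemma orthogonal_dim (U W : {vspace vT}) :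
  (U <= antisym n)%VS -> (W <= antisym n)%VS ->
  (forall x y, x \in U -> y \in W -> dot x y = 0) ->
  (\dim U + \dim W <= \dim (antisym n))%N.
Proof.
move=> hU hW h; rewrite -dimv_disjoint_sum; first by apply: dimvS; rewrite subv_add hU.
apply/eqP; rewrite -subv0; apply/subvP=> x /memv_capP[x1 x2].
by rewrite memv0; apply/eqP/dot_self0/h.
Qed.

(* The orthogonality condition says that [x o c^-1 - x] lies in the moved
   space of [v]; since [c] has no nonzero fixed vector, comparing dimensions
   forces [x o c^-1 = x o v^-1]. *)
Lemma mem_eqspace_coxc v x : v \in Bn n -> leT v c -> x \in antisym n ->
  (forall f, f \in fixspace v -> dot f (pullback c^-1 x - x) = 0) ->
  x \in eqspace v c.
Proof.
move=> hv hle hx hf.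
pose d := (pullback c - \1)%VF.
have dE f : d f = pullback c f - f by rewrite add_lfunE opp_lfunE id_lfunE.
have dotd f y : dot (d f) y = dot f (pullback c^-1 y - y).
  by rewrite dE dotB -dot_pullback dotC dotB [dot y f]dotC [dot y _]dotC.
have dU : \dim (d @: fixspace v)%VS = \dim (fixspace v).
  apply: limg_dim_eq; apply/eqP; rewrite -subv0 -fixspace_coxc subv_cap.
  by rewrite capvSr (subv_trans (capvSl _ _) (capvSl _ _)).
have hUE : (d @: fixspace v <= antisym n)%VS.
  apply/subvP=> _ /memv_imgP[f /fixspaceP[hfa _] ->]; rewrite dE.
  by rewrite memvB // antisym_pullback ?Bn_coxc.
have hWE : (eqspace v c + <[x]> <= antisym n)%VS by rewrite subv_add capvSl.
have horth y z : y \in (d @: fixspace v)%VS -> z \in (eqspace v c + <[x]>)%VS ->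
    dot y z = 0.
  case/memv_imgP=> f hfv -> /memv_addP[z1 hz1 [_ /vlineP[a ->] ->]].
  rewrite dot_additive dotZ dotd [X in _ + _ * X]dotd hf // mulr0 addr0.
  have -> : pullback c^-1 z1 = pullback v^-1 z1.
    by apply/rowP=> i; rewrite !pullbackE; case/eqspaceP: hz1 => _ ->.
  rewrite dotB -[v]invgK -dot_pullback invgK.
  have -> : pullback v f = f by apply/rowP=> i; rewrite pullbackE; case/fixspaceP: hfv => _ ->.
  by rewrite subrr.
have := orthogonal_dim hUE hWE horth; rewrite dU => hd.
have : (eqspace v c == eqspace v c + <[x]>)%VS.
  rewrite eqEdim addvSl /=; rewrite dim_leT_coxc // in hle; dim_lia.
by move/eqP=> ->; apply: (subvP (addvSr _ _)); rewrite memv_line.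
Qed.

(** By [mem_eqspace_coxc], [eqspace u c] lies in [eqspace v c]. Hence [eqspace u v] contains the
    direct sum of [fixspace v] and [eqspace u c], while it meets [fixspace u] inside [fixspace v].
    These two bounds determine its dimension. *)
Lemma leT_of_fixspace u v : u \in Bn n -> v \in Bn n -> leT u c -> leT v c ->
  (fixspace v <= fixspace u)%VS -> leT u v.
Proof.
move=> hu hv huc hvc hs.
have hD : (eqspace u c <= eqspace v c)%VS.
  apply/subvP=> x /eqspaceP[hx e]; apply: mem_eqspace_coxc => // f hf.
  have -> : pullback c^-1 x = pullback u^-1 x by apply/rowP=> i; rewrite !pullbackE e.
  rewrite dotB -[u]invgK -dot_pullback invgK.
  have -> : pullback u f = f.
    apply/rowP=> i; rewrite pullbackE.
    by have /fixspaceP[_ ->] := subvP hs _ hf.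
  by rewrite subrr.
have h1 : (fixspace v + eqspace u c <= eqspace u v)%VS.
  rewrite subv_add; apply/andP; split; apply/subvP=> x hx.
    case/fixspaceP: (hx) => hxa hxv; have /fixspaceP[_ hxu] := subvP hs _ hx.
    apply/eqspaceP; split=> // i; rewrite -[LHS]hxu -[RHS]hxv.
    by rewrite !permKV.
  have /eqspaceP[_ e] := subvP hD _ hx; case/eqspaceP: hx => hxa e'.
  by apply/eqspaceP; split=> // i; rewrite e' e.
have h2 : (\dim (fixspace v) + \dim (eqspace u c) <= \dim (eqspace u v))%N.
  rewrite -dimv_disjoint_sum; first exact: dimvS.
  apply/eqP; rewrite -subv0 -fixspace_coxc.
  by apply: subv_trans (fixspace_mulI u c); rewrite capvS.
have h3 : (\dim (fixspace u :&: eqspace u v)%VS <= \dim (fixspace v))%N.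
  by apply: dimvS; apply: fixspace_mulI.
have h4 := dimv_sum_cap (fixspace u) (eqspace u v).
have h5 : (\dim (fixspace u + eqspace u v)%VS <= \dim (antisym n))%N.
  by apply: dimvS; rewrite subv_add !capvSl.
have h6 : (\dim (fixspace v) <= \dim (fixspace u))%N by apply: dimvS.
have h7 : (\dim (fixspace u) <= \dim (antisym n))%N by rewrite dimvS ?capvSl.
have h8 : (\dim (eqspace u v) <= \dim (antisym n))%N by rewrite dimvS ?capvSl.
rewrite leTE //; rewrite dim_leT_coxc // in huc.
by apply/eqP; dim_lia.
Qed.

Lemma leT_anti u v : u \in Bn n -> v \in Bn n -> leT u v -> leT v u -> u = v.
Proof.
move=> hu hv /eqP h1 /eqP h2.
have : ellT (comp u^-1 v) = 0%N by lia.
rewrite ellTE ?BnM ?BnV // => /eqP; rewrite subn_eq0 => h.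
have /permP e : comp u^-1 v = 1%g.
  apply: perm1_of_fix; rewrite ?BnM ?BnV //.
  by apply/eqP; rewrite eqn_leq h dimvS ?capvSl.
apply/permP=> i; have := e i; rewrite compE perm1 => /(congr1 u).
by rewrite permKV => ->.
Qed.

Lemma leT1 u : leT 1%g u.
Proof.
rewrite /leT invg1; have -> : comp 1%g u = u by apply/permP=> i; rewrite compE perm1.
by rewrite ellTE ?Bn1 // fixspace1 subnn.
Qed.

Lemma eqspace_refl i j w : j != i ->
  eqspace (refl_of i j) w = fixspace (comp (refl_of i j) w).
Proof.
move=> hij; rewrite -fixspace_comp; congr (fixspace (comp _ w)).
apply/permP=> k; apply: (@perm_inj _ (refl_of i j)); rewrite permKV.
by have /permP/(_ k) := refl_ofK hij; rewrite compE perm1.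
Qed.

(** If [t <= w], the fixed space of [t w] is larger than that of [w]. Its part in the mirror of [t]
    loses at most one dimension and is fixed by [w], so it already fills [fixspace w]. *)
Lemma leT_refl_fix i j w : w \in Bn n -> j != i -> leT (refl_of i j) w ->
  (fixspace w <= evspace i j)%VS.
Proof.
move=> hw hij; set t := refl_of i j; have ht : t \in Bn n := Bn_refl_of hij.
rewrite (leTE ht hw) eqspace_refl //.
have h1 : (\dim (fixspace t) < \dim (antisym n))%N.
  rewrite ltn_neqAle dimvS ?capvSl // andbT; apply/eqP=> /(perm1_of_fix ht) /permP /(_ i).
  by rewrite perm1 refl_ofE // eqxx => /eqP; rewrite (negPf hij).
have h2 := dim_cap_evspace (fixspace (comp t w)) i j.
have h3 : (fixspace (comp t w) :&: evspace i j <= fixspace w :&: evspace i j)%VS.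
  rewrite subv_cap capvSr andbT.
  by have := fixspace_refl_mul (comp t w) hij; rewrite comp_refl_ofK.
have h4 := dimvS h3.
have h5 : (\dim (fixspace w) <= \dim (antisym n))%N by rewrite dimvS ?capvSl.
have h6 : (\dim (fixspace (comp t w)) <= \dim (antisym n))%N by rewrite dimvS ?capvSl.
move/eqP; rewrite -/t => e.
have h7 : (fixspace w :&: evspace i j == fixspace w)%VS.
  by rewrite eqEdim capvSl /=; dim_lia.
by rewrite -(eqP h7) capvSr.
Qed.

(** Through these reflections, any upper bound in the definition of [piT w] is forced to relate [i]
    and [w i]. *)
Lemma leT_refl_step w i : w \in Bn n -> w i != i -> leT (refl_of i (w i)) w.
Proof.
move=> hw hi; set t := refl_of i (w i); have ht : t \in Bn n := Bn_refl_of hi.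
rewrite (leTE ht hw) eqspace_refl // dim_fixspace_step //.
have h0 := dim_fixspace_step hi hw.
have h1 : (\dim (fixspace w) <= \dim (antisym n))%N by rewrite dimvS ?capvSl.
have h2 : (\dim (fixspace (comp t w)) <= \dim (antisym n))%N by rewrite dimvS ?capvSl.
have h3 : (\dim (fixspace t) < \dim (antisym n))%N.
  rewrite ltn_neqAle dimvS ?capvSl // andbT; apply/eqP=> /(perm1_of_fix ht) /permP /(_ i).
  by rewrite perm1 refl_ofE // eqxx => /eqP; rewrite (negPf hi).
have h4 := dim_fixspace_refl_mul 1%g hi.
have e1 : comp t 1%g = t by apply/permP=> k; rewrite compE perm1.
by rewrite -/t e1 fixspace1 in h4; rewrite -/t in h0 *; apply/eqP; dim_lia.
Qed.

End BradyWatt.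

(** * Noncrossing relations *)

Section Cyclic.
Variable n : nat.
Notation pmn := (pm n).
Notation c := (coxc n).
Implicit Types (i j k l m p q x y z : pmn) (u v w t s : {perm pmn}) (V : {set pmn}).

(* Number of steps of [c] from [x] to [z], with value [2n] (not 0) when [z = x]. *)
Definition cdist x z : nat := if (x < z)%N then (z - x)%N else (z + n.*2 - x)%N.

Lemma cdist_spec x z :
  ((x < z)%N /\ (cdist x z + x = z)%N) \/ ((z <= x)%N /\ (cdist x z + x = z + n.*2)%N).
Proof. by rewrite /cdist; have := ltn_ord x; case: (ltnP x z) => h; lia. Qed.

Lemma cdist_inj x : injective (cdist x).
Proof.
move=> y z e; apply: ord_inj; have := cdist_spec x y; have := cdist_spec x z.
have := ltn_ord y; have := ltn_ord z; lia.
Qed.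

Lemma cdist_negI x y : cdist (negI x) (negI y) = cdist x y.
Proof.
have := cdist_spec (negI x) (negI y); have := cdist_spec x y.
have := negI_val x; have := negI_val y; have := ltn_ord x; have := ltn_ord y; lia.
Qed.

Lemma negI_coxcV m : negI ((c^-1)%g m) = (c^-1)%g (negI m).
Proof. by have /BnP -> := BnV (Bn_coxc n). Qed.

Lemma coxcV_val m :
  ((0 < m)%N /\ ((c^-1)%g m).+1 = m) \/ (m = 0%N :> nat /\ ((c^-1)%g m).+1 = n.*2).
Proof.
have := coxc_val ((c^-1)%g m); rewrite permKV; have := ltn_ord m; lia.
Qed.

(** As [cdist x x] is [2n], for [x] in [V] the minimum is attained at [x] only if [V] has no other
    element. *)
Definition nextin V x : pmn := [arg min_(z < x | z \in V) cdist x z].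

Lemma nextinP V x : x \in V ->
  nextin V x \in V /\ forall z, z \in V -> (cdist x (nextin V x) <= cdist x z)%N.
Proof. by move=> hx; rewrite /nextin; case: arg_minnP. Qed.

Lemma nextin_eq V x y : x \in V -> y \in V ->
  (forall z, z \in V -> (cdist x y <= cdist x z)%N) -> nextin V x = y.
Proof.
move=> hx hy h; have [h1 h2] := nextinP hx; apply: (@cdist_inj x).
by apply/eqP; rewrite eqn_leq h2 // h.
Qed.

(** The half-open cyclic arc from [i] included to [k] excluded; it is the whole circle when
    [k = i]. *)
Definition carc i k m := (m == i :> nat) || (cdist i m < cdist i k)%N.

Lemma carc_lt i k m : (i < k)%N -> carc i k m = (i <= m < k)%N.
Proof.
move=> h; rewrite /carc; have := cdist_spec i m; have := cdist_spec i k.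
have := ltn_ord m; have := ltn_ord k; lia.
Qed.

Lemma carc_coxcV i k m : carc i k ((c^-1)%g m) = (cdist i m <= cdist i k)%N.
Proof.
rewrite /carc; have := coxcV_val m; have := cdist_spec i ((c^-1)%g m).
have := cdist_spec i m; have := cdist_spec i k.
have := ltn_ord i; have := ltn_ord m; have := ltn_ord k; lia.
Qed.

(** A discrete derivative: an arc and its translate by [c] differ only at the endpoints. *)
Lemma carc_shift i k m :
  (carc i k ((c^-1)%g m) + (m == i) = carc i k m + (m == k))%N.
Proof.
rewrite carc_coxcV /carc -!val_eqE /=.
have := cdist_spec i m; have := cdist_spec i k.
have := ltn_ord i; have := ltn_ord m; have := ltn_ord k; lia.
Qed.

(** Noncrossing partitions of type B, as equivalence relations stable under the antipode. Crossing
    is tested for the linear order; [nc_cross_cyc] transfers this to the cyclic order by cases on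
    where the cut at [0] falls. *)
Record ncrel (r : rel pmn) : Prop := NCrel {
  nc_refl : reflexive r;
  nc_sym : symmetric r;
  nc_trans : transitive r;
  nc_neg : forall x y, r x y -> r (negI x) (negI y);
  nc_cross : forall i j k l : pmn, (i < j)%N -> (j < k)%N -> (k < l)%N ->
     r i k -> r j l -> r i j }.

Lemma nc_cross_cyc r (H : ncrel r) i j k l :
  (cdist i j < cdist i k)%N -> (cdist i k < cdist i l)%N -> l != i ->
  r i k -> r j l -> r i j.
Proof.
move=> h1 h2 hli hik hjl; have hs := nc_sym H; have ht := nc_trans H.
have hli' : l <> i :> nat by move/ord_inj=> e; rewrite e eqxx in hli.
have := cdist_spec i j; have := cdist_spec i k; have := cdist_spec i l.
have := ltn_ord i; have := ltn_ord j; have := ltn_ord k; have := ltn_ord l.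
case: (ltnP i l) => h3; last first.
  case: (ltnP i k) => h4; last first.
    case: (ltnP i j) => h5 *.
      have hkl : r k l by apply: (nc_cross H) (_ : r k i) (_ : r l j); rewrite 1?hs //; lia.
      by apply: (ht) hik _; apply: (ht) hkl _; rewrite hs.
    have hjk : r j k by apply: (nc_cross H) hjl (_ : r k i); rewrite 1?hs //; lia.
    by apply: (ht) hik _; rewrite hs.
  move=> *; have hil : r l i by apply: (nc_cross H) (_ : r l j) hik; rewrite 1?hs //; lia.
  by apply: (ht) (_ : r i l) _; rewrite hs.
by move=> *; apply: (nc_cross H) hik hjl; lia.
Qed.

Definition rclass (r : rel pmn) x := [set y | r x y].
Definition nextc (r : rel pmn) x := nextin (rclass r x) x.

Lemma nextcP r x : ncrel r ->
  r x (nextc r x) /\ forall z, r x z -> (cdist x (nextc r x) <= cdist x z)%N.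
Proof.
move=> H; have hx : x \in rclass r x by rewrite inE (nc_refl H).
have [h1 h2] := nextinP hx; rewrite inE in h1; split=> // z hz.
by apply: h2; rewrite inE.
Qed.

Lemma nextc_eq r x y : ncrel r -> r x y ->
  (forall z, r x z -> (cdist x y <= cdist x z)%N) -> nextc r x = y.
Proof.
move=> H hy h; apply: nextin_eq; rewrite ?inE ?(nc_refl H) // => z; rewrite inE; exact: h.
Qed.

Lemma nextc_inj r : ncrel r -> injective (nextc r).
Proof.
move=> H x y e; have [h1 h2] := nextcP x H; have [h3 h4] := nextcP y H.
have hxy : r x y by rewrite -e in h3; apply: (nc_trans H) h1 _; rewrite (nc_sym H).
have hyx : r y x by rewrite (nc_sym H).
move: (h2 _ hxy) (h4 _ hyx); rewrite -e; set z := nextc r x.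
have := cdist_spec x y; have := cdist_spec y x; have := cdist_spec x z; have := cdist_spec y z.
have := ltn_ord x; have := ltn_ord y; have := ltn_ord z => *; apply: ord_inj; lia.
Qed.

Definition ncperm r (H : ncrel r) : {perm pmn} := perm (nextc_inj H).

Section NCPerm.
Variables (r : rel pmn) (H : ncrel r).
Notation pi := (ncperm H).

Lemma ncpermE x : pi x = nextc r x. Proof. by rewrite permE. Qed.

Lemma ncperm_rel x : r x (pi x).
Proof. by rewrite ncpermE; case: (nextcP x H). Qed.

Lemma ncperm_min x z : r x z -> (cdist x (pi x) <= cdist x z)%N.
Proof. by rewrite ncpermE; case: (nextcP x H) => _; apply. Qed.

Lemma ncperm_Bn : pi \in Bn n.
Proof.
apply/BnP=> i; rewrite !ncpermE; have [h1 h2] := nextcP i H.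
apply: nextc_eq => //; first exact: nc_neg.
move=> z /(nc_neg H); rewrite negIK => /h2.
by rewrite -(cdist_negI i (negI z)) negIK cdist_negI.
Qed.

(** The open gap between [i] and the next point of its block is a union of blocks, since a block
    leaving it would cross the block of [i]. *)
Lemma open_arc_closed i m p :
  (cdist i m < cdist i (pi i))%N -> r m p -> (cdist i p < cdist i (pi i))%N.
Proof.
move=> h hmp; rewrite ltnNge; apply/negP=> h1.
have him : ~~ r i m by apply/negP=> /ncperm_min; rewrite leqNgt h.
have hr := ncperm_rel i.
case: (eqVneq p i) => [e|hpi]; first by case/negP: him; rewrite -e (nc_sym H).
move: h1; rewrite leq_eqVlt => /orP[/eqP/cdist_inj e|h1].
  by case/negP: him; rewrite e in hr; apply: (nc_trans H) hr _; rewrite (nc_sym H).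
by case/negP: him; apply: (nc_cross_cyc H h h1).
Qed.

(** Combined with [carc_coxcV]: [pi] and [c] carry the arc from [i] to [pi i] onto the same set. *)
Lemma carc_ncperm i p : carc i (pi i) p = (cdist i (pi p) <= cdist i (pi i))%N.
Proof.
rewrite /carc; have hr := ncperm_rel p; case: (eqVneq p i) => [->|hpi].
  by rewrite eqxx leqnn.
have hpi' : (p == i :> nat) = false by apply: contraNF hpi => /eqP/ord_inj->.
rewrite hpi' /=; apply/idP/idP => h; first exact: ltnW (open_arc_closed h hr).
have hne : pi p != pi i by rewrite (inj_eq perm_inj).
have hlt : (cdist i (pi p) < cdist i (pi i))%N.
  rewrite ltn_neqAle h andbT; apply: contra hne => /eqP/cdist_inj ->; exact: eqxx.
by apply: open_arc_closed hlt _; rewrite (nc_sym H).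
Qed.

(** Each application of [pi] moves along the block without passing [j], so the cyclic distance to
    [j] drops until [j] is reached. *)
Lemma rel_porbit i j : r i j -> j \in porbit pi i.
Proof.
move: {2}(cdist i j) (leqnn (cdist i j)) => d; elim: d i => [|d IHd] i hd hr.
  have := cdist_spec i j; have := ltn_ord i; have := ltn_ord j; lia.
case: (eqVneq j (pi i)) => [->|hj]; first exact: (mem_porbit pi 1 i).
case: (eqVneq j i) => [->|hji]; first exact: porbit_id.
rewrite -(porbit_perm pi 1 i) expg1.
have hpr := ncperm_rel i.
apply: IHd; last by apply: (nc_trans H) hr; rewrite (nc_sym H).
have hm := ncperm_min hr.
have hj' : j <> pi i :> nat by move/ord_inj=> e; rewrite e eqxx in hj.
have hji' : j <> i :> nat by move/ord_inj=> e; rewrite e eqxx in hji.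
have := cdist_spec i j; have := cdist_spec i (pi i); have := cdist_spec (pi i) j.
have := ltn_ord i; have := ltn_ord j; have := ltn_ord (pi i); lia.
Qed.

End NCPerm.
End Cyclic.

(** * Elements below the Coxeter element are noncrossing *)

Section Noncrossing.
Local Open Scope ring_scope.
Variable n : nat.
Notation pmn := (pm n).
Notation vT := 'rV[rat]_(n.*2).
Notation c := (coxc n).
Implicit Types (i j k l m p q : pmn) (u v w t s : {perm pmn}) (x y f : vT).

Definition chord i k : vT := \row_m ((carc i k m)%:R - (carc i k (negI m))%:R).

Lemma chordE i k m : chord i k 0 m = (carc i k m)%:R - (carc i k (negI m))%:R.
Proof. by rewrite mxE. Qed.

Lemma chord_antisym i k : chord i k \in antisym n.
Proof. by apply/antisymP=> m; rewrite !chordE negIK opprB. Qed.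

Lemma negI_eq m i : (negI m == i) = (m == negI i).
Proof. by rewrite -{1}[i]negIK (inj_eq (inv_inj (@negIK n))). Qed.

Lemma chord_coxcV i k : pullback c^-1 (chord i k) - chord i k = evec k - evec i.
Proof.
apply/rowP=> m; have h1 := carc_shift i k m; have h2 := carc_shift i k (negI m).
rewrite !mxE pullbackE !mxE negI_coxcV -!negI_eq eqxx /=.
have {}h1 := congr1 (fun a => a%:R : rat) h1.
have {}h2 := congr1 (fun a => a%:R : rat) h2.
rewrite !natrD in h1 h2; lra.
Qed.

Lemma dot_evec f i : f \in antisym n -> dot f (evec i) = f 0 i + f 0 i.
Proof.
move=> /antisymP hf; rewrite /dot.
have hd a : \sum_k f 0 k * (k == a)%:R = f 0 a.
  by rewrite (bigD1 a) //= eqxx mulr1 big1 ?addr0 // => k /negPf->; rewrite mulr0.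
transitivity (\sum_k (f 0 k * (k == i)%:R - f 0 k * (k == negI i)%:R)).
  by apply: eq_bigr => k _; rewrite evecE mulrBr.
by rewrite sumrB !hd hf opprK.
Qed.

(** By [chord_coxcV] the derivative of the chord is [evec k - evec i], which is orthogonal to every
    function taking equal values at [i] and [k]. *)
Lemma chord_eqspace v i k : v \in Bn n -> leT v c ->
  (fixspace v <= evspace i k)%VS -> chord i k \in eqspace v c.
Proof.
move=> hv hle hs; apply: mem_eqspace_coxc => //; first exact: chord_antisym.
move=> f hf; have hfa : f \in antisym n by case/fixspaceP: hf.
rewrite chord_coxcV dotB !dot_evec //.
by have /evspaceP -> := subvP hs _ hf; rewrite subrr.
Qed.

Lemma carc_level v i k : v \in Bn n -> leT v c -> (i < k)%N ->
  (fixspace v <= evspace i k)%VS ->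
  let P m := carc i k m (+) (n < k - i)%N in
  forall m, P ((v^-1)%g m) = P ((c^-1)%g m).
Proof.
move=> hv hle hik hs P.
pose sg : rat := if (n < k - i)%N then -1 else 1.
have hP m : P m = (chord i k 0 m == sg).
  rewrite /P /sg chordE.
  have : (n < k - i)%N -> carc i k m || carc i k (negI m).
    rewrite /carc; have := cdist_spec i m; have := cdist_spec i k.
    have := cdist_spec i (negI m); have := negI_val m.
    have := ltn_ord i; have := ltn_ord m; have := ltn_ord k; lia.
  have : (n < k - i)%N = false -> carc i k m && carc i k (negI m) = false.
    rewrite /carc; have := cdist_spec i m; have := cdist_spec i k.
    have := cdist_spec i (negI m); have := negI_val m.
    have := ltn_ord i; have := ltn_ord m; have := ltn_ord k; lia.
  case: (n < k - i)%N; case: (carc i k m); case: (carc i k (negI m)) => //= h1 h2;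
  by [move: (h1 isT)|move: (h2 isT)|move: (h1 erefl)|move: (h2 erefl)|].
move=> m; rewrite !hP.
by have /eqspaceP[_ ->] := chord_eqspace hv hle hs.
Qed.

(** A [v]-fixed function has the same sum over [P] and over its image under [v], which is also its
    image under [c]. The two sets differ only by exchanging [a] and [b]. *)
Lemma level_fix v f (P : pmn -> bool) a b :
  (forall m, P ((v^-1)%g m) = P ((c^-1)%g m)) ->
  (forall m, P ((c^-1)%g m) + (m == a) = P m + (m == b))%N ->
  f \in fixspace v -> f 0 a = f 0 b.
Proof.
move=> hP hab /fixspaceP[_ hf].
have e : \sum_m f 0 m * (P ((c^-1)%g m))%:R = \sum_m f 0 m * (P m)%:R.
  rewrite (reindex_inj (@perm_inj _ v)); apply: eq_bigr => m _.
  by rewrite hf -hP permK.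
have hd z : \sum_k f 0 k * (k == z)%:R = f 0 z.
  by rewrite (bigD1 z) //= eqxx mulr1 big1 ?addr0 // => k /negPf->; rewrite mulr0.
have : \sum_m (f 0 m * (P ((c^-1)%g m))%:R + f 0 m * (m == a)%:R) =
       \sum_m (f 0 m * (P m)%:R + f 0 m * (m == b)%:R).
  by apply: eq_bigr => m _; rewrite -!mulrDr -!natrD hab.
by rewrite !big_split /= e !hd; apply: addrI.
Qed.

Definition fixrel v : rel pmn := fun i j => (fixspace v <= evspace i j)%VS.

Lemma fixrelP v i j :
  reflect (forall f, f \in fixspace v -> f 0 i = f 0 j) (fixrel v i j).
Proof. by apply: (iffP subvP) => h f hf; apply/evspaceP; apply: h. Qed.

(** For crossing pairs, intersect the level sets given by [carc_level]. In the four cases the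
    intersection is one of the arcs from [l] to [i], [k] to [l], [i] to [j], [j] to [k], and
    [level_fix] identifies its endpoints. *)
Lemma fixrel_nc v : v \in Bn n -> leT v c -> ncrel (fixrel v).
Proof.
move=> hv hle; split.
- by move=> i; apply/fixrelP.
- by move=> i j; apply/fixrelP/fixrelP => h f /h.
- move=> j i k /fixrelP h1 /fixrelP h2; apply/fixrelP => f hf.
  by rewrite h1 // h2.
- move=> i j /fixrelP h; apply/fixrelP=> f hf.
  by case/fixspaceP: (hf) => /antisymP ha _; rewrite !ha h.
move=> i j k l hij hjk hkl hik hjl.
have h1 := carc_level hv hle (ltn_trans hij hjk) hik.
have h2 := carc_level hv hle (ltn_trans hjk hkl) hjl.
pose P m := (carc i k m (+) (n < k - i)%N) && (carc j l m (+) (n < l - j)%N).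
have hP m : P ((v^-1)%g m) = P ((c^-1)%g m) by rewrite /P h1 h2.
have hab a b : (forall m, P ((c^-1)%g m) + (m == a) = P m + (m == b))%N ->
  fixrel v a b by move=> h; apply/fixrelP => f; apply: level_fix hP h.
move/fixrelP: hik => hik; move/fixrelP: hjl => hjl.
have := ltn_ord i; have := ltn_ord k; have := ltn_ord j; have := ltn_ord l => hl hj hk hi.
have hm m : (m < n.*2)%N by exact: ltn_ord.
have hik' := ltn_trans hij hjk; have hjl' := ltn_trans hjk hkl.
case hs1: (n < k - i)%N; case hs2: (n < l - j)%N.
- have /fixrelP h : fixrel v l i.
    apply: hab => m; rewrite /P hs1 hs2 /= !carc_lt // -!val_eqE /=.
    have := hm m; case: (coxcV_val m) => -[h3 h4]; lia.
  by apply/fixrelP=> f hf; rewrite hjl // h.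
- have /fixrelP h : fixrel v k l.
    apply: hab => m; rewrite /P hs1 hs2 /= !carc_lt // -!val_eqE /=.
    have := hm m; case: (coxcV_val m) => -[h3 h4]; lia.
  by apply/fixrelP=> f hf; rewrite hik // h // hjl.
- apply: hab => m; rewrite /P hs1 hs2 /= !carc_lt // -!val_eqE /=.
    have := hm m; case: (coxcV_val m) => -[h3 h4]; lia.
have /fixrelP h : fixrel v j k.
  apply: hab => m; rewrite /P hs1 hs2 /= !carc_lt // -!val_eqE /=.
    have := hm m; case: (coxcV_val m) => -[h3 h4]; lia.
by apply/fixrelP=> f hf; rewrite h // hik.
Qed.

End Noncrossing.

(** * Joins *)

Section Join.
Local Open Scope ring_scope.
Variable n : nat.
Notation pmn := (pm n).
Notation vT := 'rV[rat]_(n.*2).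
Notation c := (coxc n).
Implicit Types (i j k l m p q : pmn) (u v w t s : {perm pmn}) (x y f : vT).

Lemma antisym_sum x : x \in antisym n -> x = \sum_i (x 0 i / 2%:R) *: evec i.
Proof.
move=> /antisymP hx; apply/rowP=> m; rewrite summxE.
have hd z : \sum_k x 0 k / 2%:R * (z == k)%:R = x 0 z / 2%:R.
  rewrite (bigD1 z) //= eqxx mulr1 big1 ?addr0 // => k.
  by rewrite eq_sym => /negPf->; rewrite mulr0.
transitivity (\sum_k (x 0 k / 2%:R * (m == k)%:R - x 0 k / 2%:R * (negI m == k)%:R)).
  by rewrite sumrB !hd hx; field.
by apply: eq_bigr => k _; rewrite [RHS]mxE evecE -negI_eq mulrBr.
Qed.

Lemma evec_perm w i m : w \in Bn n -> evec i 0 (w m) = evec ((w^-1)%g i) 0 m.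
Proof.
move=> /BnV /BnP hw; rewrite !evecE -hw.
by congr (_%:R - _%:R); congr nat_of_bool; apply/eqP/eqP => [<-|->];
  rewrite ?permK ?permKV.
Qed.

(** The image of [pullback w - 1] is spanned by differences of vectors [evec], each the derivative
    of a chord up to sign. It is therefore contained in the image of [eqspace w c], which gives the
    dimension bound of [dim_leT_coxc]. *)
Lemma leT_coxc_of_chords w : w \in Bn n ->
  (forall i, chord i (w i) \in eqspace w c) -> leT w c.
Proof.
move=> hw hc; rewrite dim_leT_coxc //.
pose d := (pullback w - \1)%VF; pose e := (pullback c^-1 - \1)%VF.
have hsub : (d @: antisym n <= e @: eqspace w c)%VS.
  have he i : d (evec i) = e (- chord ((w^-1)%g i) (w ((w^-1)%g i))).
    have eN y : e (- y) = - (pullback c^-1 y - y).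
      by rewrite add_lfunE opp_lfunE id_lfunE linearN opprB opprK addrC.
    rewrite eN chord_coxcV opprB permKV add_lfunE opp_lfunE id_lfunE.
    by congr (_ - _); apply/rowP=> m; rewrite pullbackE evec_perm.
  apply/subvP=> _ /memv_imgP[x hx ->]; rewrite (antisym_sum hx) linear_sum.
  apply: memv_suml => i _; rewrite linearZ; apply: memvZ; rewrite [X in X \in _]he.
  by rewrite memv_img // memvN.
have h1 := dimvS hsub.
have h2 := limg_ker_dim d (antisym n).
have h3 := limg_ker_dim e (eqspace w c).
have h4 : (antisym n :&: lker d)%VS = fixspace w by [].
by rewrite -h2 h4 leq_add2l (leq_trans h1) // -h3 leq_addl.
Qed.

Lemma chord_eqspaceI w i k : w \in Bn n ->
  (forall p, carc i k p = carc i k ((c^-1)%g (w p))) -> chord i k \in eqspace w c.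
Proof.
move=> hw h; apply/eqspaceP; split; first exact: chord_antisym.
move=> m; rewrite !chordE h permKV; congr (_ - _%:R).
by have /BnP <- := BnV hw; rewrite h permKV negI_coxcV.
Qed.

Lemma ncperm_leT (r : rel pmn) (H : ncrel r) : leT (ncperm H) c.
Proof.
apply: leT_coxc_of_chords; first exact: ncperm_Bn.
move=> i; apply: chord_eqspaceI; first exact: ncperm_Bn.
by move=> p; rewrite carc_coxcV carc_ncperm.
Qed.

(** The fixed space has codimension at most one, so one nonzero vector in [eqspace] suffices;
    [chord i j] is one. *)
Lemma refl_leT i j : j != i -> leT (refl_of i j) c.
Proof.
move=> hij; have ht := Bn_refl_of hij; rewrite dim_leT_coxc //.
have h1 := dim_fixspace_refl_mul 1%g hij.
have e1 : comp (refl_of i j) 1%g = refl_of i j by apply/permP=> k; rewrite compE perm1.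
rewrite e1 fixspace1 in h1; apply: leq_trans h1 _.
rewrite -[(\dim _).+1]addn1 leq_add2l lt0n dimv_eq0; apply/negP=> /eqP h0.
have hn : chord i j != 0.
  apply/eqP=> e; have := chord_coxcV i j; rewrite e linear0 subrr => /rowP /(_ i).
  rewrite !mxE !eqxx (eq_sym i) (negPf hij) (eq_sym i (negI i)) (negPf (negI_neq i)).
  by case: eqP => _ /=; lra.
case/negP: hn; rewrite -memv0 -h0; apply: chord_eqspaceI => // p.
rewrite carc_coxcV refl_ofE // /carc.
have hij' : j <> i :> nat by move/ord_inj=> e; rewrite e eqxx in hij.
have := ltn_ord i; have := ltn_ord j; have := cdist_spec i j.
case: (eqVneq p i) => [->|/eqP h1]; first by rewrite eqxx leqnn.
have h1' : p <> i :> nat by move/ord_inj.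
case: (eqVneq p j) => [->|/eqP h2].
  by have := cdist_spec i i; lia.
have h2' : p <> j :> nat by move/ord_inj.
case: (eqVneq p (negI i)) => [->|h3].
  have := cdist_spec i (negI i); have := cdist_spec i (negI j).
  have := negI_val i; have := negI_val j; have := ltn_ord (negI j); lia.
case: (eqVneq p (negI j)) => [e|h4].
  move: h1'; rewrite e; have := cdist_spec i (negI i); have := cdist_spec i (negI j).
  have := negI_val i; have := negI_val j; have := ltn_ord (negI j); lia.
by have := cdist_spec i p; have := ltn_ord p; lia.
Qed.

Lemma fixspace_ncperm (r : rel pmn) (H : ncrel r) i j : r i j ->
  (fixspace (ncperm H) <= evspace i j)%VS.
Proof.
move=> /(rel_porbit H) /porbitP[k ->]; apply/subvP=> x /fixspaceP[_ h].
by apply/evspaceP; elim: k => [|k ->]; rewrite ?perm1 // expgSr permM h.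
Qed.

(** Relations coded as finite sets of pairs, so that [ncclosure] can quantify over all noncrossing
    relations and remain boolean. *)
Definition ncset (E : {set pmn * pmn}) : bool :=
  [&& [forall i, (i, i) \in E],
      [forall i, forall j, ((i, j) \in E) == ((j, i) \in E)],
      [forall j, forall i, forall k, ((i, j) \in E) ==> ((j, k) \in E) ==> ((i, k) \in E)],
      [forall i, forall j, ((i, j) \in E) ==> ((negI i, negI j) \in E)] &
      [forall i : pmn, forall j : pmn, forall k : pmn, forall l : pmn,
        ((i < j)%N && (j < k)%N && (k < l)%N) ==>
        ((i, k) \in E) ==> ((j, l) \in E) ==> ((i, j) \in E)]].

Lemma ncsetP (E : {set pmn * pmn}) : reflect (ncrel (fun i j => (i, j) \in E)) (ncset E).
Proof.
apply: (iffP and5P) => [[h1 h2 h3 h4 h5]|[h1 h2 h3 h4 h5]]; split.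
- by move=> i; apply: (forallP h1).
- by move=> i j; apply/eqP; apply: (forallP (forallP h2 i)).
- move=> j i k a b.
  by have /implyP/(_ a)/implyP/(_ b) := forallP (forallP (forallP h3 j) i) k.
- by move=> i j a; have /implyP/(_ a) := forallP (forallP h4 i) j.
- move=> i j k l a b d e f.
  have /implyP := forallP (forallP (forallP (forallP h5 i) j) k) l.
  by rewrite a b d => /(_ isT) /implyP/(_ e)/implyP/(_ f).
- exact/forallP.
- by apply/forallP=> i; apply/forallP=> j; rewrite h2.
- apply/forallP=> j; apply/forallP=> i; apply/forallP=> k.
  by apply/implyP=> a; apply/implyP=> b; apply: h3 a b.
- by apply/forallP=> i; apply/forallP=> j; apply/implyP=> a; apply: h4.
apply/forallP=> i; apply/forallP=> j; apply/forallP=> k; apply/forallP=> l.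
by apply/implyP=> /andP[/andP[a b] d]; apply/implyP=> e; apply/implyP=> f; apply: h5 e f.
Qed.

Definition ncclosure w : rel pmn := fun i j =>
  [forall E : {set pmn * pmn},
     (ncset E && [forall m, (m, w m) \in E]) ==> ((i, j) \in E)].

Lemma ncclosureP w i j : reflect
  (forall r : rel pmn, ncrel r -> (forall m, r m (w m)) -> r i j) (ncclosure w i j).
Proof.
apply: (iffP forallP) => [h r H hw|h E]; last first.
  apply/implyP=> /andP[/ncsetP H /forallP hw].
  exact: (h (fun i j => (i, j) \in E)).
pose E := [set p | r p.1 p.2].
have /implyP := h E; rewrite inE; apply; apply/andP; split; last first.
  by apply/forallP=> m; rewrite inE.
apply/ncsetP; case: H => h1 h2 h3 h4 h5; split.
- by move=> a; rewrite inE.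
- by move=> a b; rewrite !inE h2.
- by move=> a b d; rewrite !inE; apply: h3.
- by move=> a b; rewrite !inE; apply: h4.
by move=> a b d e h6 h7 h8; rewrite !inE; apply: h5 h6 h7 h8.
Qed.

Lemma ncclosure_min w (r : rel pmn) i j : ncrel r -> (forall m, r m (w m)) ->
  ncclosure w i j -> r i j.
Proof. by move=> H hw /ncclosureP; apply. Qed.

Lemma ncclosure_perm w m : ncclosure w m (w m).
Proof. by apply/ncclosureP=> r _; apply. Qed.

Lemma ncclosure_nc w : ncrel (ncclosure w).
Proof.
split.
- by move=> i; apply/ncclosureP => r H _; apply: nc_refl.
- by move=> i j; apply/ncclosureP/ncclosureP => h r H hw; rewrite (nc_sym H) h.
- move=> j i k /ncclosureP h1 /ncclosureP h2; apply/ncclosureP=> r H hw.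
  exact: (nc_trans H) (h1 _ H hw) (h2 _ H hw).
- by move=> i j /ncclosureP h; apply/ncclosureP=> r H hw; apply: nc_neg => //; apply: h.
move=> i j k l a b d /ncclosureP h1 /ncclosureP h2; apply/ncclosureP=> r H hw.
exact: (nc_cross H) a b d (h1 _ H hw) (h2 _ H hw).
Qed.

(* Two antipodal classes are intertwined, so noncrossing merges all balanced
   cycles into a single class. *)
Lemma rel_of_fixspace (r : rel pmn) w i j : ncrel r -> (forall m, r m (w m)) ->
  w \in Bn n -> (fixspace w <= evspace i j)%VS -> r i j.
Proof.
move=> H hw /BnP hB hs; apply/negP=> /negP hij.
have hrw a m : r a (w m) = r a m.
  apply/idP/idP => h; last by apply: (nc_trans H) h (hw m).
  by apply: (nc_trans H) h _; rewrite (nc_sym H).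
have hrn a b : r (negI a) b = r a (negI b).
  by apply/idP/idP => /(nc_neg H); rewrite negIK.
pose z a : vT := \row_m ((r a m)%:R - (r a (negI m))%:R).
have hz a : z a \in fixspace w.
  apply/fixspaceP; split; first by apply/antisymP=> m; rewrite !mxE negIK opprB.
  by move=> m; rewrite !mxE -hB !hrw.
have hi : r i (negI i).
  have /evspaceP := subvP hs _ (hz i); rewrite !mxE (nc_refl H) (negPf hij).
  by case: (r i (negI i)) => //; case: (r i (negI j)) => /=; lra.
have hj : r j (negI j).
  have /evspaceP := subvP hs _ (hz j); rewrite !mxE (nc_refl H) (nc_sym H) (negPf hij).
  by case: (r j (negI j)) => //; case: (r j (negI i)) => /=; lra.
case/negP: hij; case: (eqVneq i j) => [->|e1]; first exact: nc_refl.
case: (eqVneq (negI j) i) => [<-|e2]; first by rewrite (nc_sym H).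
have e1' : i <> j :> nat by move/ord_inj=> e; rewrite e eqxx in e1.
have e2' : negI j <> i :> nat by move/ord_inj=> e; rewrite e eqxx in e2.
have := ltn_ord i; have := ltn_ord j; have := negI_val i; have := negI_val j.
have := cdist_spec i j; have := cdist_spec i (negI i); have := cdist_spec i (negI j).
case: (ltnP (cdist i j) (cdist i (negI i))) => h.
  by move=> *; apply: (nc_cross_cyc H h (_ : _ < cdist i (negI j))%N e2 hi hj); lia.
move=> *; apply: (nc_trans H) (_ : r (negI j) j); last by rewrite (nc_sym H).
apply: (nc_cross_cyc H (_ : _ < cdist i (negI i))%N (_ : _ < cdist i j)%N _ hi);
  [lia|lia|by rewrite eq_sym|by rewrite (nc_sym H)].
Qed.

(** All comparisons are made through fixed spaces, using [leT_of_fixspace]. *)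
Lemma piTE w : w \in Bn n -> piT w = ncperm (ncclosure_nc w).
Proof.
move=> hw; set H := ncclosure_nc w; set p := ncperm H.
have hp : p \in Bn n := ncperm_Bn H.
have hpc : leT p c := ncperm_leT H.
have hpN : p \in NCB n by rewrite inE hp leT1 hpc.
have hub : [forall t in [set t in reflB n | leT t w], leT t p].
  apply/forallP=> t; apply/implyP; rewrite inE => /andP[/refl_ofP[i [j [hij ->]]] ht].
  have hs := rel_of_fixspace H (ncclosure_perm w) hw (leT_refl_fix hw hij ht).
  apply: leT_of_fixspace; rewrite ?Bn_refl_of ?refl_leT //.
  apply/subvP=> x hx; have hxa := subvP (fixspace_antisym p) _ hx.
  apply/fixspaceP; split=> // k; apply: refl_of_fix => //.
  exact/evspaceP/(subvP (fixspace_ncperm H hs)).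
(* [fixrel v] is noncrossing and relates every [m] to [w m], hence contains the closure; so
   functions fixed by [v] are fixed by [p]. *)
have hlub v : v \in NCB n -> [forall t in [set t in reflB n | leT t w], leT t v] -> leT p v.
  rewrite inE => /and3P[hv _ hvc] /forallP hall.
  have hfw m : fixrel v m (w m).
    rewrite /fixrel; case: (eqVneq (w m) m) => [->|hm].
      by apply/subvP=> x _; apply/evspaceP.
    apply: leT_refl_fix => //; have /implyP := hall (refl_of m (w m)); apply.
    by rewrite inE leT_refl_step // andbT; apply/refl_ofP; exists m, (w m).
  apply: leT_of_fixspace => //; apply/subvP=> x hx.
  case/fixspaceP: (hx) => hxa _; apply/fixspaceP; split=> // m; apply/esym.
  have := ncclosure_min (fixrel_nc hv hvc) hfw (ncperm_rel H m).
  by move/fixrelP; apply.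
rewrite /piT /NCjoin; case: pickP => [u|/(_ p)]; last first.
  rewrite hpN hub /= => /negP; case; apply/forallP=> v; apply/implyP=> hv.
  by apply/implyP; apply: hlub.
case/and3P=> hu hu1 hu2 /=; have hup : leT u p.
  by have /implyP/(_ hpN)/implyP/(_ hub) := forallP hu2 p.
apply: leT_anti => //; first by move: hu; rewrite inE => /andP[].
exact: hlub.
Qed.

End Join.

(** * Descents along an orbit *)

Section Descents.
Variable n : nat.
Notation pmn := (pm n).
Notation c := (coxc n).
Implicit Types (i j k l m p q x y z : pmn) (u v w t s : {perm pmn}).

Definition descents w := [set y : pmn | (w y < y)%N].

Lemma card_antiexc w : #|antiexc w| = #|descents w|.
Proof.
rewrite -(card_imset (descents w) (@perm_inj _ w)); apply: eq_card => i.
rewrite inE; apply/idP/imsetP => [h|[y]].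
  by exists ((w^-1)%g i); rewrite ?inE permKV.
by rewrite inE => h ->; rewrite permK.
Qed.

(** Putting all moved points into one class and leaving fixed points alone is already a noncrossing
    relation. *)
Lemma ncclosure_fix w x y : w \in Bn n -> ncclosure w x y ->
  x = y \/ (w x != x /\ w y != y).
Proof.
move=> /BnP hw.
pose r : rel pmn := fun x y => (x == y) || (w x != x) && (w y != y).
suff H : ncrel r.
  move/(ncclosure_min H) => h; have /orP[/eqP|/andP[h1 h2]] : r x y.
  - by apply: h => m; rewrite /r (inj_eq perm_inj) eq_sym orbC; case: eqP.
  - by left.
  by right.
split.
- by move=> a; rewrite /r eqxx.
- by move=> a b; rewrite /r eq_sym andbC.
- by move=> b a d /orP[/eqP->//|/andP[h1 h2]] /orP[/eqP<-|/andP[h3 h4]];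
    rewrite /r ?h1 ?h2 ?h4 orbT.
- move=> a b; rewrite /r !hw !(inj_eq (inv_inj (@negIK n))); exact.
move=> i j k l h1 h2 h3 /orP[/eqP e|/andP[h4 _]]; first by rewrite e in h1; lia.
move=> /orP[/eqP e|/andP[h5 _]]; first by rewrite e in h2; lia.
by rewrite /r h4 h5 orbT.
Qed.

Lemma piT_fix w x : w \in Bn n -> w x = x -> piT w x = x.
Proof.
move=> hw hx; rewrite piTE //.
by case: (ncclosure_fix hw (ncperm_rel (ncclosure_nc w) x)) => [<-|[]] //; rewrite hx eqxx.
Qed.

Lemma piT_rel w x : w \in Bn n -> ncclosure w x (piT w x).
Proof. by move=> hw; rewrite piTE // ncperm_rel. Qed.

Lemma piT_min w x z : w \in Bn n -> ncclosure w x z -> (cdist x (piT w x) <= cdist x z)%N.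
Proof. by move=> hw; rewrite piTE //; apply: ncperm_min. Qed.

Lemma piT_Bn w : w \in Bn n -> piT w \in Bn n.
Proof. by move=> hw; rewrite piTE // ncperm_Bn. Qed.

Lemma PopTE w x : PopT w (piT w x) = w x.
Proof. by rewrite /PopT compE permK. Qed.

Lemma PopT_Bn w : w \in Bn n -> PopT w \in Bn n.
Proof. by move=> hw; rewrite BnM ?BnV ?piT_Bn. Qed.

Lemma descents_piT_sub w : w \in Bn n -> descents (piT w) \subset descents w.
Proof.
move=> hw; apply/subsetP=> y; rewrite !inE => h.
have h1 := piT_min hw (ncclosure_perm w y).
have h2 : w y <> y :> nat.
  by move=> /ord_inj /(piT_fix hw) e; rewrite e ltnn in h.
have := cdist_spec y (w y); have := cdist_spec y (piT w y).
have := ltn_ord (w y); lia.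
Qed.

(** [PopT w] sends [piT w y] to [w y]. Going forward from [y], the point [piT w y] comes no later
    than [w y], so this is a descent exactly when the way to [w y] wraps past the end and the way to
    [piT w y] does not. *)
Lemma descents_PopT w : w \in Bn n ->
  (#|descents (PopT w)| + #|descents (piT w)|)%N = #|descents w|.
Proof.
move=> hw; have hsub := descents_piT_sub hw.
rewrite -(cardsID (descents (piT w)) (descents w)) (setIidPr hsub) addnC; congr (_ + _)%N.
rewrite -(card_imset (_ :\: _) (@perm_inj _ (piT w))); apply: eq_card => x.
have hy y : (w y < piT w y)%N = (y \in descents w :\: descents (piT w)).
  rewrite !inE; have h1 := piT_min hw (ncclosure_perm w y).
  have h2 : w y = y :> nat -> piT w y = y :> nat.
    by move=> /ord_inj /(piT_fix hw) ->.
  have := cdist_spec y (w y); have := cdist_spec y (piT w y).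
  have := ltn_ord (w y); have := ltn_ord (piT w y); lia.
rewrite inE; apply/idP/imsetP => [h|[y]].
  by exists ((piT w)^-1%g x); rewrite ?permKV // -hy permKV -PopTE permKV.
by rewrite -hy => h ->; rewrite PopTE.
Qed.

Lemma descents_eq0 u : #|descents u| = 0%N -> u = 1%g.
Proof.
move=> /eqP; rewrite cards_eq0 => /eqP h.
have hu y : (y <= u y)%N.
  rewrite leqNgt; apply/negP=> hy; have : y \in descents u by rewrite inE.
  by rewrite h inE.
apply/permP=> x; rewrite perm1; apply/eqP/negPn/negP=> hx.
case: (@arg_maxnP _ x [pred y | u y != y] (fun y : pmn => nat_of_ord y) hx) => y /= hy hmax.
have hyy : u (u y) != u y by rewrite (inj_eq perm_inj).
have := hmax _ hyy; have := hu y => h1 h2; case/eqP: hy; apply: ord_inj.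
by apply/eqP; rewrite eqn_leq h1 h2.
Qed.

Lemma piT1 : piT (1%g : {perm pmn}) = 1%g.
Proof. by apply/permP=> x; rewrite piT_fix ?Bn1 // perm1. Qed.

Lemma piT_neq1 w : w \in Bn n -> w != 1%g -> (0 < #|descents (piT w)|)%N.
Proof.
move=> hw h1; rewrite lt0n; apply: contraNneq h1 => h.
apply/eqP/permP=> x; rewrite perm1; apply/eqP/negPn/negP=> hx.
have hp := descents_eq0 h; have hm := piT_min hw (ncclosure_perm w x).
rewrite hp perm1 in hm; have hx' : w x <> x :> nat by move/ord_inj/eqP; apply/negP.
have := cdist_spec x (w x); have := cdist_spec x x; have := ltn_ord (w x); lia.
Qed.

Lemma orbit_size1 : orbit_size (1%g : {perm pmn}) = 1%N.
Proof.
rewrite /orbit_size -(card1 (1%g : {perm pmn})); apply: eq_card => u; rewrite !inE.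
have h1 : PopT (1%g : {perm pmn}) = 1%g.
  by apply/permP=> x; rewrite /PopT piT1 compE invg1 !perm1.
have hk (k : nat) : iter k (@PopT n) 1%g = 1%g.
  by elim: k => [|k IHk]; [done|rewrite iterS IHk].
apply/idP/eqP => [h|->]; last exact: connect0.
by rewrite -(iter_findex h) hk.
Qed.

(** The number of descents drops strictly at the first step and never grows, so [w] does not
    recur. *)
Lemma orbit_sizeS w : w \in Bn n -> w != 1%g ->
  orbit_size w = (orbit_size (PopT w)).+1.
Proof.
move=> hw h1; rewrite /orbit_size.
have hnot : w \notin fconnect (@PopT n) (PopT w).
  apply/negP=> /iter_findex; move: (findex _ _ _) => k.
  have hk d : (iter d (@PopT n) (PopT w) \in Bn n) &&
     (#|descents (iter d (@PopT n) (PopT w))| <= #|descents (PopT w)|)%N.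
    elim: d => [|d /andP[IH1 IH2]]; first by rewrite (PopT_Bn hw) leqnn.
    rewrite iterS (PopT_Bn IH1); have := descents_PopT IH1; lia.
  move=> e; have := hk k; rewrite e => /andP[_].
  have := descents_PopT hw; have := piT_neq1 hw h1; lia.
transitivity #|predU1 w (fconnect (@PopT n) (PopT w))|.
  apply: eq_card => u; rewrite !inE -[RHS]/((u == w) || _) eq_sym.
  exact: fconnect_eqVf.
by rewrite cardU1 hnot.
Qed.

Lemma orbit_size_le w : w \in Bn n -> (orbit_size w <= #|descents w|.+1)%N.
Proof.
move e: #|descents w| => d; elim/ltn_ind: d w e => d IHd w e hw.
case: (eqVneq w 1%g) => [->|h1]; first by rewrite orbit_size1.
rewrite orbit_sizeS // ltnS.
have h2 := descents_PopT hw; have h3 := piT_neq1 hw h1.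
have hlt : (#|descents (PopT w)| < d)%N by lia.
by apply: leq_trans (IHd _ hlt _ erefl (PopT_Bn hw)) hlt.
Qed.

(** A rotated block descends only at its maximum, so nontrivial cycles correspond to descents. *)
Lemma cyc_ncperm (r : rel pmn) (H : ncrel r) :
  cyc (ncperm H) = #|descents (ncperm H)|.
Proof.
set p := ncperm H.
have hmin x z : r x z -> (cdist x (p x) <= cdist x z)%N by apply: ncperm_min.
have hpr x y : y \in porbit p x -> r x y.
  case/porbitP=> k ->; elim: k => [|k IHk]; first by rewrite perm1 (nc_refl H).
  by rewrite expgSr permM; apply: (nc_trans H) IHk (ncperm_rel H _).
have hmax y z : (p y < y)%N -> r y z -> (z <= y)%N.
  move=> h /hmin; have := cdist_spec y z; have := cdist_spec y (p y).
  have := ltn_ord z; lia.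
rewrite /cyc -(card_in_imset (f := porbit p)); last first.
  move=> y z; rewrite !inE => hy hz e.
  have hyz : r y z by apply: hpr; rewrite e porbit_id.
  have hzy : r z y by rewrite (nc_sym H).
  by apply: ord_inj; apply/eqP; rewrite eqn_leq (hmax _ _ hz hzy) (hmax _ _ hy hyz).
apply: eq_card => C; rewrite inE; apply/andP/imsetP => [[/imsetP[x _ ->] hC]|[y]].
  have [y hy hym] : exists2 y, y \in porbit p x & forall z, z \in porbit p x -> (z <= y)%N.
    by case: (@arg_maxnP _ x [pred z | z \in porbit p x] (fun y : pmn => nat_of_ord y) (porbit_id p x)) => y hy h; exists y.
  exists y; last by apply/eqP; rewrite eq_porbit_mem porbit_sym.
  have hpy : p y \in porbit p x.
    by move: hy; rewrite -!eq_porbit_mem => /eqP <-; rewrite -(porbit_perm p 1 y) expg1.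
  rewrite inE ltn_neqAle hym // andbT; apply/negP=> /eqP/ord_inj e.
  have : (#|porbit p x| <= 1)%N; last by rewrite leqNgt hC.
  rewrite -(cards1 y); apply: subset_leq_card; apply/subsetP=> z.
  have -> : porbit p x = porbit p y by apply/eqP; rewrite eq_sym eq_porbit_mem.
  rewrite inE => /porbitP[k ->]; apply/eqP.
  by elim: k => [|k IHk]; rewrite ?perm1 // expgSr permM IHk.
rewrite inE => hy ->; split; first exact: imset_f.
rewrite (cardsD1 y) porbit_id add1n ltnS card_gt0; apply/set0Pn; exists (p y).
rewrite !inE (mem_porbit p 1 y) andbT.
by apply: contraTneq hy => ->; rewrite ltnn.
Qed.

Lemma cyc_piT w : w \in Bn n -> cyc (piT w) = #|descents (piT w)|.
Proof. by move=> hw; rewrite piTE // cyc_ncperm. Qed.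

End Descents.

(** * Cyclic successors *)

Section Successor.
Variable n : nat.
Notation pmn := (pm n).
Notation c := (coxc n).
Implicit Types (i j x y z s : pmn) (u v w t : {perm pmn}) (V S : {set pmn}).

Definition csuccf V x := if x \in V then nextin V x else x.

Lemma csuccf_inj V : injective (csuccf V).
Proof.
have hV x : x \in V -> csuccf V x \in V.
  by rewrite /csuccf => hx; rewrite hx; case: (nextinP hx).
move=> x y; case hx: (x \in V); case hy: (y \in V).
- rewrite /csuccf hx hy => e; have [h1 h2] := nextinP hx; have [_ h4] := nextinP hy.
  move: (h2 _ hy) (h4 _ hx); rewrite -e; set z := nextin V x.
  have := cdist_spec x y; have := cdist_spec y x; have := cdist_spec x z; have := cdist_spec y z.
  have := ltn_ord x; have := ltn_ord y; have := ltn_ord z => *; apply: ord_inj; lia.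
- by move=> e; have := hV _ hx; rewrite e /csuccf hy hy.
- by move=> e; have := hV _ hy; rewrite -e /csuccf hx hx.
by rewrite /csuccf hx hy.
Qed.

Definition csucc V : {perm pmn} := perm (@csuccf_inj V).

Lemma csucc_out V x : x \notin V -> csucc V x = x.
Proof. by move=> hx; rewrite permE /csuccf (negPf hx). Qed.

Lemma csucc_in V x : x \in V -> csucc V x \in V.
Proof. by move=> hx; rewrite permE /csuccf hx; case: (nextinP hx). Qed.

Lemma csucc_min V x z : x \in V -> z \in V -> (cdist x (csucc V x) <= cdist x z)%N.
Proof. by move=> hx; rewrite permE /csuccf hx; case: (nextinP hx) => _; apply. Qed.

Lemma csucc_eq V x y : x \in V -> y \in V ->
  (forall z, z \in V -> (cdist x y <= cdist x z)%N) -> csucc V x = y.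
Proof. by move=> hx hy h; rewrite permE /csuccf hx; apply: nextin_eq. Qed.

Lemma csuccT : csucc setT = c.
Proof.
apply/permP=> x; apply: csucc_eq; rewrite ?inE // => z _.
have := coxc_val x; have := cdist_spec x z; have := cdist_spec x (c x).
have := ltn_ord z; have := ltn_ord x; lia.
Qed.

Definition negclosed V := forall x, (negI x \in V) = (x \in V).

Lemma csucc_Bn V : negclosed V -> csucc V \in Bn n.
Proof.
move=> hV; apply/BnP=> x; case hx: (x \in V); last first.
  by rewrite !csucc_out // ?hV hx.
apply: csucc_eq; rewrite ?hV ?csucc_in // => z hz.
have hz' : negI z \in V by rewrite hV.
by rewrite cdist_negI; have := csucc_min hx hz'; rewrite -(cdist_negI x (negI z)) negIK.
Qed.

Lemma ncperm_csucc (r : rel pmn) (H : ncrel r) V :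
  (forall x y, r x y = (x == y) || (x \in V) && (y \in V)) -> ncperm H = csucc V.
Proof.
move=> hr; apply/permP=> x; have hrx := ncperm_rel H x.
case hx: (x \in V); last first.
  by move: hrx; rewrite hr hx orbF => /eqP <-; rewrite csucc_out ?hx.
apply/esym/csucc_eq => //.
  by move: hrx; rewrite hr hx => /orP[/eqP <-|].
by move=> z hz; apply: ncperm_min; rewrite hr hx hz orbT.
Qed.

(** By symmetry the successor of [negI s] is then [s], and the two empty gaps cover the circle. *)
Lemma csucc_neg_card S s : negclosed S -> s \in S -> csucc S s = negI s -> (#|S| <= 2)%N.
Proof.
move=> hS hs e; have e' : csucc S (negI s) = s.
  by have /BnP -> := csucc_Bn hS; rewrite e negIK.
apply: leq_trans (_ : #|[set s; negI s]| <= 2)%N; last by rewrite cards2; case: eqP.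
apply: subset_leq_card; apply/subsetP=> z hz; rewrite !inE.
have h1 := csucc_min hs hz; rewrite e in h1.
have hns : negI s \in S by rewrite hS.
have h2 := csucc_min hns hz; rewrite e' in h2.
case: (eqVneq z s) => //= /eqP z1; case: (eqVneq z (negI s)) => //= /eqP z2; exfalso.
have {}z1 : z <> s :> nat by move/ord_inj.
have {}z2 : z <> negI s :> nat by move/ord_inj.
have := ltn_ord s; have := ltn_ord z; have := negI_val s.
have := cdist_spec s z; have := cdist_spec s (negI s).
have := cdist_spec (negI s) z; have := cdist_spec (negI s) s; lia.
Qed.

Section Index.
Variables (V : {set pmn}) (x0 : pmn) (V0 : (0 < #|V|)%N).
Notation M := #|V|.

(** Cyclic enumeration of [V] in increasing order; it turns [csucc V] into [k |-> k + 1]. The point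
    [x0] is only the default of [nth]. *)
Definition nthc (k : nat) : pmn := nth x0 (enum V) (k %% M).

Lemma nthc_in k : nthc k \in V.
Proof. by rewrite -mem_enum mem_nth // -cardE ltn_pmod. Qed.

Lemma nthcM k : nthc (k + M) = nthc k.
Proof. by rewrite /nthc modnDr. Qed.

Lemma nthc_mod k : nthc (k %% M) = nthc k.
Proof. by rewrite /nthc modn_mod. Qed.

Lemma nthc_lt a b : (a < b)%N -> (b < M)%N -> (nthc a < nthc b)%N.
Proof.
move=> hab hb; rewrite /nthc !modn_small //; last exact: ltn_trans hb.
have hs : sorted (relpre (@nat_of_ord n.*2) ltn) (enum V).
  rewrite /enum_mem -enumT; apply: sorted_filter; first by move=> ? ? ?; apply: ltn_trans.
  by rewrite -sorted_map val_enum_ord iota_ltn_sorted.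
have ht : transitive (relpre (@nat_of_ord n.*2) ltn) by move=> ? ? ?; apply: ltn_trans.
apply: (sorted_ltn_nth ht x0 hs) => //; rewrite inE -cardE //; exact: ltn_trans hb.
Qed.

Lemma nthc_surj z : z \in V -> exists2 k, (k < M)%N & z = nthc k.
Proof.
move=> hz; have hi : (index z (enum V) < M)%N by rewrite cardE index_mem mem_enum.
by exists (index z (enum V)) => //; rewrite /nthc modn_small // nth_index // mem_enum.
Qed.

Lemma nthc_shift b d : (b < M)%N -> (d <= M)%N ->
  nthc (b + d) = nthc (if b + d < M then b + d else b + d - M)%N.
Proof.
by move=> hb hd; case: ltnP => // h; rewrite -[in LHS](subnK h) nthcM.
Qed.

(** The bound includes [e = M], a full turn back to [nthc b], thanks to the value [2n] of
    [cdist x x]. *)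
Lemma cdist_nthc_lt b d e : (0 < d)%N -> (d < e)%N -> (e <= M)%N ->
  (cdist (nthc b) (nthc (b + d)) < cdist (nthc b) (nthc (b + e)))%N.
Proof.
move=> hd hde he.
wlog hb : b / (b < M)%N => [H|].
  have hm : (b %% M < M)%N by rewrite ltn_pmod.
  have := H _ hm; rewrite nthc_mod.
  have hs k : nthc (b %% M + k) = nthc (b + k) by rewrite -nthc_mod modnDml nthc_mod.
  by rewrite !hs.
have hlt a a' : (a < a')%N -> (a' < M)%N -> (nthc a < nthc a')%N by apply: nthc_lt.
rewrite !nthc_shift //; last lia.
case: (ltnP (b + d) M) => h1; case: (ltnP (b + e) M) => h2; try lia.
- have := hlt b (b + d)%N; have := hlt (b + d)%N (b + e)%N.
  have := cdist_spec (nthc b) (nthc (b + d)); have := cdist_spec (nthc b) (nthc (b + e)).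
  by lia.
- have := hlt b (b + d)%N.
  have : (nthc (b + e - M) <= nthc b)%N.
    case: (ltnP (b + e - M) b) => h3; first exact/ltnW/hlt.
    have e1 : (b + e - M)%N = b by lia.
    by rewrite e1.
  have := ltn_ord (nthc (b + d)).
  have := cdist_spec (nthc b) (nthc (b + d)); have := cdist_spec (nthc b) (nthc (b + e - M)).
  by lia.
have := hlt (b + d - M)%N (b + e - M)%N.
have : (nthc (b + e - M) <= nthc b)%N.
  case: (ltnP (b + e - M) b) => h3; first exact/ltnW/hlt.
  have e1 : (b + e - M)%N = b by lia.
  by rewrite e1.
have := cdist_spec (nthc b) (nthc (b + d - M)); have := cdist_spec (nthc b) (nthc (b + e - M)).
by lia.
Qed.

Lemma nthc_after b z : z \in V -> exists d, [/\ (0 < d)%N, (d <= M)%N & z = nthc (b + d)].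
Proof.
move=> /nthc_surj[k hk ->].
have hm : (b %% M < M)%N by rewrite ltn_pmod.
have hs (j : nat) : nthc (b %% M + j) = nthc (b + j) by rewrite -nthc_mod modnDml nthc_mod.
case: (ltnP (b %% M) k) => h.
  exists (k - b %% M)%N; split; [lia|lia|].
  by rewrite -(hs (k - b %% M)%N) subnKC // ltnW.
exists (k + M - b %% M)%N; split; [lia|lia|].
by rewrite -(hs (k + M - b %% M)%N) subnKC ?nthcM //; lia.
Qed.

Lemma csucc_first_return S b a : S \subset V -> (b < a)%N -> (a <= b + M)%N ->
  nthc b \in S -> nthc a \in S -> (forall j : nat, (b < j < a)%N -> nthc j \notin S) ->
  csucc S (nthc b) = nthc a.
Proof.
move=> hSV hba haM hb ha hno; apply: csucc_eq => // z hz.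
have [d [hd1 hd2 hzd]] := nthc_after b (subsetP hSV _ hz).
have -> : a = (b + (a - b))%N by lia.
case: (ltngtP d (a - b)) => h.
- have hb' : (b < b + d < a)%N by lia.
  by have := hno _ hb'; rewrite -hzd hz.
- by rewrite hzd; apply: ltnW; apply: cdist_nthc_lt; lia.
by rewrite hzd h.
Qed.

Lemma csucc_nthc k : csucc V (nthc k) = nthc k.+1.
Proof.
apply: csucc_first_return; rewrite ?nthc_in //; first by lia.
by move=> j; lia.
Qed.

Lemma csuccX_nthc L k : (csucc V ^+ L)%g (nthc k) = nthc (k + L).
Proof.
elim: L => [|L IHL]; first by rewrite perm1 addn0.
by rewrite expgSr permM IHL csucc_nthc addnS.
Qed.

Lemma nthc_eq a b : (nthc a = nthc b) <-> (a = b %[mod M]).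
Proof.
split=> [|e]; last by rewrite -nthc_mod e nthc_mod.
rewrite -(nthc_mod a) -(nthc_mod b) => e.
case: (ltngtP (a %% M) (b %% M)) => // h.
  by have := nthc_lt h; rewrite e ltn_pmod // => /(_ isT); rewrite ltnn.
by have := nthc_lt h; rewrite e ltn_pmod // => /(_ isT); rewrite ltnn.
Qed.

(** The antipode commutes with [csucc V], hence shifts indices by a constant [m < M]. It is an
    involution without fixed points, so [2m] is a multiple of [M] and [m] is not zero. *)
Lemma nthc_neg : negclosed V ->
  exists m, M = m.*2 /\ forall k, negI (nthc k) = nthc (k + m).
Proof.
move=> hV; have /nthc_surj[m hm e0] : negI (nthc 0) \in V by rewrite hV nthc_in.
have hk k : negI (nthc k) = nthc (k + m).
  elim: k => [|k IHk]; first by rewrite e0.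
  by rewrite -csucc_nthc -(BnP _ (csucc_Bn hV)) IHk csucc_nthc addSn.
exists m; split=> //; have := hk m; rewrite -e0 negIK addnn.
move/nthc_eq; rewrite mod0n => e; have hm0 : m <> 0%N.
  by move=> e1; move: e0; rewrite e1 => e0; have := negI_neq (nthc 0); rewrite e0 eqxx.
have := divn_eq m.*2 M; rewrite -e addn0.
case: (m.*2 %/ M)%N => [|[|q]]; [lia|lia|nia].
Qed.

End Index.
End Successor.

(** * The states of the iteration *)

(** An innermost class of a noncrossing relation is an interval. If the class of [lo] does not fill
    the range, its first gap is a union of classes, and induction applies to this shorter range. *)
Lemma interval_class (M : nat) (r : nat -> nat -> bool) :
  (forall a, r a a) -> (forall a b, r a b = r b a) ->
  (forall a b d, r a b -> r b d -> r a d) ->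
  (forall a b d e, a < b -> b < d -> d < e -> e < M -> r a d -> r b e -> r a b) ->
  forall lo hi, lo < hi -> hi <= M ->
  (forall a b, lo <= a < hi -> b < M -> r a b -> lo <= b < hi) ->
  exists a p, [/\ lo <= a, 0 < p, a + p <= hi,
    forall b, b < M -> r a b -> a <= b < a + p & forall k, k < p -> r a (a + k)].
Proof.
move=> hr hs ht hx lo hi; move: {2}(hi - lo) (leqnn (hi - lo)) => d.
elim: d lo hi => [|d IHd] lo hi hd hlt hM hcl; first lia.
case hall: (all (r lo) (iota lo (hi - lo))).
  exists lo, (hi - lo); split=> //; [lia|lia| |].
    by move=> b hb hlb; have := hcl lo b; rewrite leqnn hlt => /(_ isT hb hlb); lia.
  by move=> k hk; apply: (allP hall); rewrite mem_iota; lia.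
have [k0 hk0 hrk0] : exists2 k, lo <= k < hi & ~~ r lo k.
  move/negbT: hall => /allPn[k]; rewrite mem_iota => hk hrk; exists k => //; lia.
have hex : exists k, (lo <= k < hi) && ~~ r lo k by exists k0; rewrite hk0.
case: (ex_minnP hex) => k /andP[hk hrk] hmin.
have hbelow x : lo <= x -> x < k -> r lo x.
  move=> h1 h2; apply/negPn/negP=> h3; have := hmin x; rewrite h3 h1 andbT => /(_ _); lia.
(* The gap starts at [k], the first point unrelated to [lo], and ends at [k'], the next related
   point or [hi]. *)
have hex2 : exists k', (k < k') && ((k' == hi) || r lo k').
  by exists hi; rewrite eqxx andbT; lia.
case: (ex_minnP hex2) => k' /andP[hkk' hk'] hmin'.
have hk'hi : k' <= hi by apply: hmin'; rewrite eqxx andbT; lia.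
have hno x : k <= x < k' -> ~~ r lo x.
  move=> /andP[h1 h2]; case: (eqVneq x k) => [->//|hne]; apply/negP=> h3.
  by have := hmin' x; rewrite h3 orbT andbT => /(_ _); lia.
have hlok : lo < k.
  by rewrite ltn_neqAle; case/andP: hk => -> _; rewrite andbT; apply: contraNneq hrk => <-.
have [||||a [p [h1 h2 h3 h4 h5]]] := IHd k k'; try lia.
  move=> a b ha hb hab; have hao := hno _ ha.
  have hbr : lo <= b < hi by apply: hcl hb hab; lia.
  apply/andP; split; rewrite leqNgt; apply/negP=> hlt'.
    case/negP: hao; rewrite hs in hab; apply: ht hab; apply: hbelow => //; lia.
  case: (ltngtP k' b) => hkb; [|lia|].
    case/orP: hk' => [/eqP e|hk']; first lia.
    by case/negP: hao; apply: (hx lo a k' b) => //; lia.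
  case/orP: hk' => [/eqP e|hk']; first lia.
  by case/negP: hao; rewrite hs in hab; apply: ht hab; rewrite -hkb.
by exists a, p; split=> //; lia.
Qed.

Section States.
Variable n : nat.
Notation pmn := (pm n).
Notation c := (coxc n).
Implicit Types (x y z s : pmn) (u v w t : {perm pmn}) (V S : {set pmn}).

(** Every [L] consecutive points of [V] meet [S]: the gaps of [S] in [V] have length at most [L]. *)
Definition hits V S (L : nat) :=
  forall x, x \in V -> exists2 k : nat, k < L & (csucc V ^+ k)%g x \in S.

(** The product [*] applies its left factor first, so [csucc S] is inverted after the [L] steps in
    [V]. *)
Definition stateperm V S (L : nat) : {perm pmn} := ((csucc V ^+ L) * (csucc S)^-1)%g.

Lemma statepermE V S L x : csucc S (stateperm V S L x) = (csucc V ^+ L)%g x.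
Proof. by rewrite permM permKV. Qed.

Section Connected.
Variables (V S : {set pmn}) (L : nat) (r : rel pmn).
Hypotheses (HV : negclosed V) (HS : negclosed S) (HSV : S \subset V) (HS2 : 2 < #|S|).
Hypotheses (HL : 1 < L) (HLV : L < #|V|) (Hh : hits V S L.-1).
Hypotheses (H : ncrel r) (Hw : forall x, r x (stateperm V S L x)).

Let V0 : 0 < #|V|. Proof. lia. Qed.

(** The state moves [L] steps forward and, on landing in [S], falls back to the preceding point of
    [S]. By [Hh] it stays strictly ahead of its start; a fall of [m] or more would be a gap of half
    a turn, excluded by [csucc_neg_card]. *)
Lemma state_displacement (x0 : pmn) m : #|V| = m.*2 ->
  (forall k, negI (nthc V x0 k) = nthc V x0 (k + m)) ->
  forall k, exists d, [/\ 0 < d, d <= L, stateperm V S L (nthc V x0 k) = nthc V x0 (k + d) &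
   d = L \/ [/\ L - d < m, nthc V x0 (k + L) \in S &
               forall j, k + d < j < k + L -> nthc V x0 j \notin S]].
Proof.
move=> hM hneg k; set X := nthc V x0.
have hwk := statepermE V S L (X k); rewrite csuccX_nthc // -/X in hwk.
case hkS: (X (k + L) \in S); last first.
  exists L; split; [lia|lia| |by left].
  by apply: (@perm_inj _ (csucc S)); rewrite hwk csucc_out ?hkS.
have [i hi hiS] := Hh (nthc_in x0 V0 k.+1).
rewrite csuccX_nthc // -/X in hiS.
pose P b := (k < b < k + L) && (X b \in S).
have hex : exists b, P b by exists (k.+1 + i); rewrite /P hiS andbT; lia.
have hub b : P b -> b <= k + L by case/andP; lia.
case: (ex_maxnP hex hub) => b /andP[hb hbS] hmax.
have hno (j : nat) : b < j < k + L -> X j \notin S.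
  by move=> hj; apply/negP=> hjS; have := hmax j; rewrite /P hjS andbT => /(_ _); lia.
have hfr : csucc S (X b) = X (k + L).
  by apply: csucc_first_return => //; lia.
exists (b - k); split; [lia|lia| |].
  have -> : k + (b - k) = b by lia.
  by apply: (@perm_inj _ (csucc S)); rewrite hwk hfr.
right; split=> //; last by move=> j hj; apply: hno; lia.
rewrite ltnNge; apply/negP=> hge.
have hbmS : X (b + m) \in S by rewrite /X -hneg HS.
case: (ltnP (b + m) (k + L)) => h.
  by have := hno (b + m); rewrite hbmS => /(_ _); lia.
have e : b + m = k + L by lia.
have e2 : csucc S (X b) = negI (X b) by rewrite hfr -e /X hneg.
by have := csucc_neg_card HS hbS e2; lia.
Qed.

Lemma state_connected x y : x \in V -> y \in V -> r x y.
Proof.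
move=> hx hy; pose X := nthc V x.
have [m [hM hneg]] := nthc_neg x V0 HV.
have hdisp := state_displacement hM hneg.
have hX k : X (k + #|V|) = X k by apply: nthcM.
have hrs := nc_sym H; have hrt := nc_trans H.
(* Some class, read in the indices of [V], is an interval of [p] points starting at [a]. It remains
   to exclude [p < #|V|]. *)
have [|||||a [p [_ hp hap hcl hin]]] :=
    @interval_class #|V| (fun a b => r (X a) (X b)) _ _ _ _ 0 #|V| V0 (leqnn _).
- by move=> a; apply: nc_refl.
- by move=> a b; apply: hrs.
- by move=> a b d h1 h2; apply: hrt h1 h2.
- move=> a b d e h1 h2 h3 h4; apply: (nc_cross H); apply: nthc_lt => //; lia.
- by move=> a b _ hb _.
case: (ltnP p #|V|) => hpM; last first.
  have [k hk ->] := nthc_surj x hx; have [l hl ->] := nthc_surj x hy.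
  have a0 : a = 0 by lia.
  rewrite a0 in hin; apply: hrt (hin l _); last lia.
  by rewrite hrs; apply: hin; lia.
exfalso.
have hY e : e < #|V| -> r (X a) (X (a + e)) -> e < p.
  move=> he; rewrite /X nthc_shift //; try lia; case: ltnP => h1 h2.
    by have := hcl _ h1 h2; lia.
  by have := hcl (a + e - #|V|); rewrite h2 => /(_ _ isT); lia.
(* A class longer than half a turn would meet its antipode, merge with it, and contain the index
   [a + 2m - 1]. *)
have hpm : p <= m.
  rewrite leqNgt; apply/negP=> hmp.
  have h1 := hin m hmp; have h2 := nc_neg H (hin m.-1 _).
  rewrite /X !hneg in h2; have h3 := hrt _ _ _ h1 (h2 _).
  by have := hY (m.-1 + m); rewrite addnA h3; lia.
have hw k e : k < p -> stateperm V S L (X (a + k)) = X (a + e) -> e < #|V| -> e < p.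
  move=> hk hE he; apply: hY he _; rewrite -hE.
  exact: hrt (hin k hk) (Hw _).
have [d [hd1 hd2 hd3 _]] := hdisp (a + p.-1).
(* The last point of the class moves forward, so it must go past the complement of the class, which
   has at least [m] points. *)
have hLm : m < L.
  case: (ltnP (p.-1 + d) #|V|) => h1; last lia.
  have := hw p.-1 (p.-1 + d); rewrite addnA hd3 => /(_ _ erefl h1); lia.
(* The first point must stay among fewer than [L] steps, so it falls back: [a + L] lies in [S]. The
   second point cannot fall back behind [a + L], so it leaves the class; if it would wrap round to
   [a], the bound [L - d0 < m] is violated. *)
have [d0 [h01 h02 h03 h04]] := hdisp a.
have hd0p : d0 < p by apply: (hw 0) => //; [rewrite addn0 h03|lia].
case: h04 => [|[h04 h05 h06]]; first lia.
have [d1 [h11 h12 h13 h14]] := hdisp a.+1.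
have hd1p e : e = d1.+1 -> e < #|V| -> e < p.
  by move=> he hlt; apply: (hw 1) hlt; [lia|rewrite addn1 h13 he addnS addSn].
case: h14 => [e|[h14 h15 h16]].
  by have := hd1p d1.+1 erefl; lia.
case: (ltnP d1.+1 L) => h2.
  have := hd1p d1.+1 erefl; case: (ltnP (a.+1 + d1) (a + L)) => h3; last lia.
  by have := h16 (a + L); rewrite h05 => /(_ _); lia.
have := hd1p d1.+1 erefl; lia.
Qed.

End Connected.

Lemma stateperm_out V S L x : S \subset V -> x \notin V -> stateperm V S L x = x.
Proof.
move=> hSV hx; have hxS : x \notin S by apply: contra hx; apply: (subsetP hSV).
apply: (@perm_inj _ (csucc S)); rewrite statepermE csucc_out //.
by elim: L => [|L IHL]; rewrite ?perm1 // expgSr permM IHL csucc_out.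
Qed.

Lemma comp_expg u L : u \in Bn n -> (u ^+ L)%g \in Bn n.
Proof. by move=> hu; elim: L => [|L IHL]; [exact: Bn1|rewrite expgS; apply: (BnM IHL hu)]. Qed.

Lemma stateperm_Bn V S L : negclosed V -> negclosed S -> stateperm V S L \in Bn n.
Proof.
by move=> hV hS; apply: (BnM (BnV (csucc_Bn hS)) (comp_expg L (csucc_Bn hV))).
Qed.

Lemma piT_state V S L : negclosed V -> negclosed S -> S \subset V -> 2 < #|S| ->
  1 < L -> L < #|V| -> hits V S L.-1 -> piT (stateperm V S L) = csucc V.
Proof.
move=> hV hS hSV hS2 hL hLV hh; have hw := stateperm_Bn L hV hS.
rewrite piTE //; apply: ncperm_csucc => x y.
apply/idP/idP => [/(ncclosure_fix hw)[->|[h1 h2]]|/orP[/eqP->|/andP[hx hy]]].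
- by rewrite eqxx.
- apply/orP; right; apply/andP; split.
    by apply: contraNT h1 => h1; rewrite stateperm_out.
  by apply: contraNT h2 => h2; rewrite stateperm_out.
- exact: nc_refl (ncclosure_nc _) _.
by apply: (state_connected hV hS hSV hS2 hL hLV hh (ncclosure_nc _)) => // z; apply: ncclosure_perm.
Qed.

Lemma PopT_state V S L : negclosed V -> negclosed S -> S \subset V -> 2 < #|S| ->
  1 < L -> L < #|V| -> hits V S L.-1 ->
  PopT (stateperm V S L) = stateperm V S L.-1.
Proof.
move=> hV hS hSV hS2 hL hLV hh; rewrite /PopT piT_state //.
by rewrite /comp /stateperm -[in LHS](prednK (ltnW hL)) expgS !mulgA mulVg mul1g.
Qed.

End States.

(** * Filling a gap of length [L] and removing its starting point *)

Section Shrink.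
Variable n : nat.
Notation pmn := (pm n).

(** The second clause adds the points of [V] in the gap after [s]. It does not bring [s] back when
    the gap ends elsewhere, because [cdist s s] is [2n]. *)
Definition fillgap (V S : {set pmn}) (s : pmn) : {set pmn} :=
  [set z | (z \in S :\ s) || (z \in V) && (cdist s z <= cdist s (csucc S s))].

Section OneGap.
Variables (V S : {set pmn}) (s : pmn) (L : nat).
Hypotheses (HSV : S \subset V) (Hs : s \in S) (HL : 0 < L) (HLV : L < #|V|).
Hypothesis (HsL : csucc S s = (csucc V ^+ L)%g s).
Notation V1 := (V :\ s).
Notation S1 := (fillgap V S s).
Notation M := #|V|.

Let HsV : s \in V. Proof. exact: (subsetP HSV). Qed.
Let V0 : 0 < M. Proof. lia. Qed.

Section WithIndex.
Variable b : nat.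
Notation X := (nthc V s).
Hypothesis Hb : s = X b.

Lemma gap_end : csucc S s = X (b + L).
Proof. by rewrite HsL {1}Hb csuccX_nthc. Qed.

Lemma nthc_eq_gap j : j < M -> (X (b + j) == s) = (j == 0).
Proof.
move=> hj; apply/eqP/eqP => [|->]; last by rewrite addn0 -Hb.
rewrite {2}Hb -[in X b](addn0 b) => /(nthc_eq s V0) /eqP.
by rewrite eqn_modDl mod0n modn_small // => /eqP.
Qed.

Lemma gap_none j : 0 < j < L -> X (b + j) \notin S.
Proof.
move=> /andP[h1 h2]; apply/negP=> /(csucc_min Hs); rewrite gap_end {1 3}Hb.
by rewrite leqNgt cdist_nthc_lt //; lia.
Qed.

Lemma fillgap_nthc j : 0 < j < M -> (X (b + j) \in S1) = (j <= L) || (X (b + j) \in S).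
Proof.
move=> /andP[h1 h2]; rewrite !inE nthc_in // nthc_eq_gap // gap_end.
have -> : (j == 0) = false by lia.
rewrite /= orbC; congr (_ || _).
have e k : cdist s (X (b + k)) = cdist (X b) (X (b + k)) by rewrite -Hb.
rewrite !e; case: (leqP j L) => h.
  by case: (ltngtP j L) h => // [h|->] _; rewrite ?leqnn // ltnW // cdist_nthc_lt //; lia.
by apply/negbTE; rewrite -ltnNge cdist_nthc_lt //; lia.
Qed.

Lemma fillgap_notin : s \notin S1.
Proof.
rewrite !inE eqxx /= HsV /= -ltnNge gap_end.
have := cdist_spec s s; have := cdist_spec s (X (b + L)); have := ltn_ord (X (b + L)).
have : X (b + L) != s by rewrite nthc_eq_gap //; lia.
by case: (ltngtP (X (b + L)) s) => [|h|/ord_inj ->]; rewrite ?eqxx //; lia.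
Qed.

Lemma fillgap_sub : S1 \subset V1.
Proof.
apply/subsetP=> z hz; rewrite !inE; apply/andP; split.
  by apply: contraTneq hz => ->; apply: fillgap_notin.
by move: hz; rewrite !inE => /orP[/andP[_ /(subsetP HSV)]|/andP[]].
Qed.

Lemma csucc_fill_gap j : 0 < j < L -> csucc S1 (X (b + j)) = X (b + j).+1.
Proof.
move=> hj; have h1 := subset_trans fillgap_sub (subD1set V s).
apply: csucc_first_return => //; try lia.
- by rewrite fillgap_nthc; lia.
by rewrite -addnS fillgap_nthc; lia.
Qed.

(** Only the predecessor of [s] is affected: it now jumps to [X b.+1], the first point of the filled
    gap. *)
Lemma csucc_fill_old v : v \in S -> v != s ->
  csucc S1 v = if csucc S v == s then X b.+1 else csucc S v.
Proof.
move=> hv hvs; have h1 := subset_trans fillgap_sub (subD1set V s).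
have hsub := subsetP HSV.
have [j [hj1 hj2 hvj]] := nthc_after s V0 b (hsub _ hv).
have hjM : j < M.
  rewrite ltn_neqAle hj2 andbT; apply: contraNneq hvs => e.
  by rewrite hvj e nthcM // -Hb.
have hjL : L <= j.
  by rewrite leqNgt; apply/negP=> h; have := @gap_none j; rewrite -hvj hv => /(_ _); lia.
have [d [hd1 hd2 hvd]] := nthc_after s V0 (b + j) (hsub _ (csucc_in hv)).
have hno k : 0 < k < d -> X (b + j + k) \notin S.
  move=> hk; apply/negP=> /(csucc_min hv); rewrite hvd hvj.
  by rewrite leqNgt cdist_nthc_lt //; lia.
have hno1 k : j < k < j + d -> k < M -> X (b + k) \notin S1.
  move=> hk hkM; rewrite fillgap_nthc; last lia.
  have -> : b + k = b + j + (k - j) by lia.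
  by rewrite negb_or hno ?andbT; lia.
have hvS1 : X (b + j) \in S1 by rewrite fillgap_nthc ?hjM ?hj1 // -hvj hv orbT.
have hXM : X (b + M) = s by rewrite nthcM -Hb.
case: eqP => [e|e].
  have hjd : j + d = M.
    have : X (b + (j + d)) = X (b + 0) by rewrite addnA -hvd e addn0 -Hb.
    move/(nthc_eq s V0)/eqP; rewrite eqn_modDl mod0n.
    case: (ltngtP (j + d) M) => // h; first by rewrite modn_small //; lia.
    have -> : j + d = (j + d - M) + M by lia.
    by rewrite modnDr modn_small; lia.
  rewrite hvj -(nthcM V s b.+1); apply: csucc_first_return => //; try lia.
    rewrite nthcM -addn1 fillgap_nthc; lia.
  move=> k hk; case: (ltnP k (b + M)) => hkM.
    have -> : k = b + (k - b) by lia.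
    by apply: hno1; lia.
  have -> : k = b + M by lia.
  by rewrite hXM fillgap_notin.
have hjd : j + d < M.
  case: (ltngtP (j + d) M) => // h.
    have := hno (M - j); have -> : b + j + (M - j) = b + M by lia.
    by rewrite hXM Hs => /(_ _); lia.
  by case: e; rewrite hvd -addnA h.
rewrite hvd hvj; apply: csucc_first_return => //; try lia.
  by rewrite -addnA fillgap_nthc ?hjd ?addnA -?hvd ?csucc_in ?orbT //; lia.
move=> k hk; have -> : k = b + (k - b) by lia.
by apply: hno1; lia.
Qed.

(** The boolean counts one extra index when the path jumps over the removed point at [b + M]. *)
Lemma csuccX_gap e j : 0 < e < M -> j < M ->
  (csucc V1 ^+ j)%g (X (b + e)) = X (b + e + j + (M - e <= j)).
Proof.
move=> he; elim: j => [|j IHj] hj; first by rewrite perm1 addn0; congr X; lia.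
rewrite expgSr permM IHj; last lia.
have hXM : X (b + M) = s by rewrite nthcM -Hb.
have hXM1 k : X (b + M + k) = X (b + k) by rewrite -addnA (addnC M) addnA nthcM.
have hin k : 0 < k < M -> X (b + k) \in V1.
  by move=> hk; rewrite !inE nthc_eq_gap ?nthc_in //; lia.
case: (ltngtP (M - e) j.+1) => h.
- have -> : (M - e <= j) = true by lia.
  have -> : b + e + j + true = b + M + (e + j + 1 - M) by lia.
  have -> : b + e + j.+1 + true = (b + M + (e + j + 1 - M)).+1 by lia.
  apply: csucc_first_return => //; try lia; rewrite ?subD1set //.
  + by rewrite hXM1 hin //; lia.
  + by rewrite -addnS hXM1 hin //; lia.
- have -> : (M - e <= j) = false by lia.
  have -> : b + e + j + false = b + (e + j) by lia.
  have -> : b + e + j.+1 + false = b + (e + j).+1 by lia.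
  apply: csucc_first_return => //; try lia; rewrite ?subD1set //.
  + by rewrite hin //; lia.
  + by rewrite hin //; lia.
have -> : (M - e <= j) = false by lia.
have -> : b + e + j + false = b + (e + j) by lia.
have -> : b + e + j.+1 + true = b + M + 1 by lia.
apply: csucc_first_return => //; try lia; rewrite ?subD1set //.
+ by rewrite hin //; lia.
+ by rewrite hXM1 hin //; lia.
move=> k hk; have -> : k = b + M by lia.
by rewrite hXM !inE eqxx.
Qed.

(** [s] is fixed on both sides. For a path of [L] steps that stops before [s], nothing changes; one
    that reaches or passes [s] gains an index, and the modified successor in [S1] compensates for
    it. *)
Lemma stateperm_fillgap_idx : stateperm V1 S1 L = stateperm V S L.
Proof.
apply/permP=> x; apply: (@perm_inj _ (csucc S1)); rewrite statepermE.
case hx: (x \in V); last first.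
  rewrite [in RHS]stateperm_out ?hx // csucc_out; last first.
    by apply: contraFN hx => /(subsetP fillgap_sub); rewrite !inE => /andP[].
  elim: (L) => [|k IHk]; rewrite ?perm1 // expgSr permM IHk csucc_out //.
  by rewrite !inE hx andbF.
have hws : stateperm V S L s = s.
  by apply: (@perm_inj _ (csucc S)); rewrite statepermE HsL.
case: (eqVneq x s) => [->|hxs].
  rewrite hws (csucc_out fillgap_notin).
  elim: (L) => [|k IHk]; rewrite ?perm1 // expgSr permM IHk csucc_out //.
  by rewrite !inE eqxx.
have [e [he1 he2 hxe]] := nthc_after s V0 b hx.
have heM : e < M.
  rewrite ltn_neqAle he2 andbT; apply: contraNneq hxs => h.
  by rewrite hxe h nthcM // -Hb.
rewrite hxe csuccX_gap ?he1 //; set y := stateperm V S L _.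
have hy : csucc S y = X (b + e + L) by rewrite statepermE csuccX_nthc.
case: (ltnP (e + L) M) => h.
  have -> : (M - e <= L) = false by lia.
  rewrite addn0; case hu: (X (b + e + L) \in S); last first.
    have -> : y = X (b + e + L) by apply: (@perm_inj _ (csucc S)); rewrite hy csucc_out ?hu.
    by rewrite csucc_out // -addnA fillgap_nthc ?addnA ?hu; lia.
  have hyS : y \in S.
    by apply: contraTT hu => hyS; rewrite -hy (csucc_out hyS).
  have hys : y != s.
    apply/eqP=> hys; have := nthc_eq_gap h; move: hy; rewrite hys gap_end.
    rewrite -addnA => /(nthc_eq s V0)/eqP; rewrite eqn_modDl !modn_small //; lia.
  rewrite csucc_fill_old // hy; case: eqP => // /eqP.
  by rewrite -addnA nthc_eq_gap //; lia.
have -> : (M - e <= L) = true by lia.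
have hXM1 k : X (b + M + k) = X (b + k) by rewrite -addnA (addnC M) addnA nthcM.
have e1 : b + e + L = b + M + (e + L - M) by lia.
have -> : b + e + L + true = b + M + (e + L - M).+1 by lia.
(* Either the old path ends at [s] itself, or it ends strictly inside the gap, where [S] has no
   point and [S1] has all of them. *)
rewrite e1 !hXM1 in hy; rewrite hXM1; case: (posnP (e + L - M)) => h0.
  rewrite h0 addn0 -Hb in hy; rewrite h0 addn1.
  have hyS : y \in S.
    by apply: contraTT Hs => hyS; rewrite -hy (csucc_out hyS).
  have hys : y != s.
    apply/eqP=> hys; move: hy; rewrite hys gap_end => /eqP; rewrite nthc_eq_gap //; lia.
  by rewrite csucc_fill_old // hy eqxx.
have -> : y = X (b + (e + L - M)).
  by apply: (@perm_inj _ (csucc S)); rewrite hy csucc_out // gap_none; lia.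
by rewrite csucc_fill_gap ?addnS //; lia.
Qed.

(** A window whose hit comes before [s] keeps it; any other window jumps over [s] and hits the
    filled point after it. *)
Lemma hits_fillgap_idx : hits V S L -> hits V1 S1 L.
Proof.
move=> hh x; rewrite !inE => /andP[hxs hx].
have [e [he1 he2 hxe]] := nthc_after s V0 b hx.
have heM : e < M.
  rewrite ltn_neqAle he2 andbT; apply: contraNneq hxs => h.
  by rewrite hxe h nthcM // -Hb.
have [k hk] := hh _ hx; rewrite hxe csuccX_nthc // => hkS.
case: (ltnP k (M - e)) => h.
  exists k => //; rewrite csuccX_gap ?he1 //; last lia.
  have -> : (M - e <= k) = false by lia.
  by rewrite addn0 -addnA fillgap_nthc ?addnA ?hkS ?orbT //; lia.
exists (M - e); first lia.
rewrite csuccX_gap ?he1 // ?leqnn; last lia.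
have -> : b + e + (M - e) + true = b + 1 + M by lia.
by rewrite nthcM fillgap_nthc //; lia.
Qed.

Lemma card_fillgap_idx : 1 < L -> #|S| <= #|S1|.
Proof.
move=> hL; have h1 : X (b + 1) \notin S by apply: gap_none; lia.
have : #|X (b + 1) |: (S :\ s)| <= #|S1|.
  apply: subset_leq_card; apply/subsetP=> z /setU1P[->|hz].
    by rewrite fillgap_nthc //; lia.
  by rewrite inE hz.
by rewrite cardsU1 in_setD1 (negPf h1) andbF (cardsD1 s S) Hs.
Qed.

End WithIndex.

Lemma gap_index : exists b, s = nthc V s b.
Proof. by have [b _ e] := nthc_surj s HsV; exists b. Qed.

Lemma stateperm_fillgap : stateperm V1 S1 L = stateperm V S L.
Proof. by have [b hb] := gap_index; apply: stateperm_fillgap_idx hb. Qed.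

Lemma hits_fillgap : hits V S L -> hits V1 S1 L.
Proof. by have [b hb] := gap_index; apply: hits_fillgap_idx hb. Qed.

Lemma card_fillgap : 1 < L -> #|S| <= #|S1|.
Proof. by have [b hb] := gap_index; apply: card_fillgap_idx hb. Qed.

Lemma fillgap_subD1 : S1 \subset V1.
Proof. by have [b hb] := gap_index; apply: fillgap_sub hb. Qed.

Lemma csucc_fillgap v : v \in S -> v != s -> csucc S v != s -> csucc S1 v = csucc S v.
Proof.
by have [b hb] := gap_index => h1 h2 h3; rewrite (csucc_fill_old hb) // (negPf h3).
Qed.

Lemma csuccX_D1 v : v \in S -> v != s -> csucc S v != s -> csucc S v = (csucc V ^+ L)%g v ->
  (csucc V1 ^+ L)%g v = (csucc V ^+ L)%g v.
Proof.
have [b hb] := gap_index => hv hvs hvs' hvL.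
have [e [he1 he2 hve]] := nthc_after s V0 b (subsetP HSV _ hv).
have heM : e < M.
  rewrite ltn_neqAle he2 andbT; apply: contraNneq hvs => h.
  by rewrite hve h nthcM // -hb.
rewrite hve (csuccX_gap hb) ?he1 // csuccX_nthc //.
case: (leqP (M - e) L) => h; last by rewrite addn0.
have hXM : nthc V s (b + e + (M - e)) = s.
  have -> : b + e + (M - e) = b + M by lia.
  by rewrite nthcM -hb.
have := csucc_min hv Hs; rewrite hvL hve csuccX_nthc // -[X in _ <= cdist _ X]hXM.
rewrite leq_eqVlt ltnNge (_ : _ <= _) ?orbF; last first.
  case: (ltngtP (M - e) L) h => // [h|->] _ //.
  by apply/ltnW/cdist_nthc_lt => //; lia.
move=> /eqP/cdist_inj e1; case/negP: hvs'.
by rewrite hvL hve csuccX_nthc // e1 hXM.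
Qed.

End OneGap.
End Shrink.

(** * Orbit sizes *)

Section Orbits.
Variable n : nat.
Notation pmn := (pm n).
Implicit Types (x y z s : pmn) (u v w t : {perm pmn}) (V S : {set pmn}).

Lemma gap_lt_half V S s L m : negclosed V -> negclosed S -> S \subset V -> 2 < #|S| ->
  s \in S -> L < #|V| -> csucc S s = (csucc V ^+ L)%g s -> #|V| = m.*2 -> L < m.
Proof.
move=> hV hS hSV hS2 hs hLV hgap hm.
have V0 : 0 < #|V| by lia.
have [b hbM hb] := nthc_surj s (subsetP hSV _ hs).
have [m' [hm' hneg]] := nthc_neg s V0 hV.
have emm : m' = m by lia.
rewrite emm in hneg; have hns : negI s \in S by rewrite hS.
have hmin := csucc_min hs hns.
have e1 : negI s = nthc V s (b + m) by rewrite {1}hb hneg.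
have e2 : csucc S s = nthc V s (b + L) by rewrite hgap {1}hb csuccX_nthc.
rewrite ltnNge; apply/negP; rewrite leq_eqVlt => /orP[/eqP e|h].
  by have := csucc_neg_card hS hs; rewrite e2 -e -e1 => /(_ erefl); lia.
move: hmin; rewrite e1 e2 {1 3}hb leqNgt cdist_nthc_lt //; lia.
Qed.

(** One filling breaks the antipodal symmetry, so the gap at [negI s] is filled next. The first
    filling leaves that gap intact because it does not end at [s]. *)
Lemma fillgap_pair V S s L : negclosed V -> negclosed S -> S \subset V -> 2 < #|S| ->
  1 < L -> L < #|V| -> hits V S L -> s \in S -> csucc S s = (csucc V ^+ L)%g s ->
  exists V' S', [/\ negclosed V', negclosed S', S' \subset V' & 2 < #|S'|] /\
    [/\ L < #|V'|, #|V'| < #|V|, hits V' S' L & stateperm V' S' L = stateperm V S L].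
Proof.
move=> hV hS hSV hS2 hL hLV hh hs hgap.
have hL0 : 0 < L by lia.
have V0 : 0 < #|V| by lia.
have [m [hm _]] := nthc_neg s V0 hV.
have hLm := gap_lt_half hV hS hSV hS2 hs hLV hgap hm.
pose s' := negI s; have hs' : s' \in S by rewrite hS.
have hss' : s' != s by apply: negI_neq.
have cS : csucc S s' = negI (csucc S s) by rewrite (BnP _ (csucc_Bn hS)).
have hne : csucc S s' != s.
  apply/eqP=> e; have := csucc_neg_card hS hs.
  by rewrite -[csucc S s]negIK -cS e => /(_ erefl); lia.
have hgap' : csucc S s' = (csucc V ^+ L)%g s'.
  by rewrite cS hgap (BnP _ (comp_expg L (csucc_Bn hV))).
pose V1 := V :\ s; pose S1 := fillgap V S s.
have hs'1 : s' \in S1 by rewrite !inE hss' hs'.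
have hc1 : csucc S1 s' = csucc S s' by apply: (csucc_fillgap hSV hs hL0 hLV hgap).
have hgap1 : csucc S1 s' = (csucc V1 ^+ L)%g s'.
  by rewrite hc1 (csuccX_D1 hSV hs hL0 hLV hs' hss' hne hgap').
have hV1 : #|V| = #|V1|.+1 by rewrite (cardsD1 s V) (subsetP hSV _ hs).
have hS1V1 : S1 \subset V1 by apply: (fillgap_subD1 hSV hs hL0 hLV hgap).
have hV2 : #|V1| = #|V1 :\ s'|.+1 by rewrite (cardsD1 s' V1) (subsetP hS1V1 _ hs'1).
have hLV1 : L < #|V1| by lia.
exists (V1 :\ s'), (fillgap V1 S1 s'); split; split.
- move=> z; rewrite !inE hV !negI_eq negIK.
  by rewrite /s'; case: (z == s); case: (z == negI s).
- have far : cdist s (csucc S s) < cdist s s'.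
    rewrite ltn_neqAle csucc_min // andbT; apply: contraNneq hne => /cdist_inj e.
    by rewrite cS e negIK.
  have far' : cdist s' (csucc S s') < cdist s' s.
    by rewrite cS cdist_negI -(cdist_negI s' s) negIK.
  (* A description of the doubly filled set that is visibly symmetric in [s] and [s']; [far] and
     [far'] say that neither gap reaches the other starting point. *)
  have hmem z : (z \in fillgap V1 S1 s') =
     [&& z != s, z != s' & z \in S] ||
     (z \in V) && ((cdist s z <= cdist s (csucc S s)) || (cdist s' z <= cdist s' (csucc S s'))).
    rewrite inE hc1 !inE.
    case: (eqVneq z s) => [->|h1] /=.
      have h1 : cdist s s <= cdist s (csucc S s) = false.
        apply/negbTE; rewrite -ltnNge; apply: leq_trans far _.
        have := cdist_spec s s; have := cdist_spec s s'; have := ltn_ord s'; lia.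
      by rewrite (leqNgt (cdist s' s)) far' h1 !andbF.
    case: (eqVneq z s') => [->|h2] //=.
      rewrite (leqNgt (cdist s s')) far /=.
      by case: (s' \in V).
    by case: (z \in S); case: (z \in V); rewrite ?orbT //=; do ?case: (_ <= _).
  move=> z; rewrite !hmem hV hS !negI_eq negIK -/s'.
  rewrite -(cdist_negI s (negI z)) -(cdist_negI s' (negI z)) !negIK -/s' cS cdist_negI.
  rewrite -(cdist_negI s (csucc S s)) -cS -/s'.
  by case: (z == s); case: (z == s'); case: (z \in S); case: (z \in V) => //=; rewrite orbC.
- exact: (fillgap_subD1 hS1V1 hs'1 hL0 hLV1 hgap1).
- apply: leq_trans (card_fillgap hS1V1 hs'1 hL0 hLV1 hgap1 hL).
  exact: leq_trans (card_fillgap hSV hs hL0 hLV hgap hL).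
- lia.
- lia.
- apply: (hits_fillgap hS1V1 hs'1 hL0 hLV1 hgap1).
  exact: (hits_fillgap hSV hs hL0 hLV hgap).
rewrite (stateperm_fillgap hS1V1 hs'1 hL0 hLV1 hgap1).
exact: (stateperm_fillgap hSV hs hL0 hLV hgap).
Qed.

(** Induction on [#|V| + L]. If windows of length [L - 1] still hit [S], Pop lowers [L]; otherwise
    some gap has length exactly [L], and [fillgap_pair] shrinks [V] without changing the
    permutation. *)
Lemma orbit_size_state V S L : negclosed V -> negclosed S -> S \subset V -> 2 < #|S| ->
  0 < L -> L < #|V| -> hits V S L -> orbit_size (stateperm V S L) = L.
Proof.
move: {2}(#|V| + L) (leqnn (#|V| + L)) => d; elim: d V S L => [|d IHd] V S L hd; first lia.
move=> hV hS hSV hS2 hL0 hLV hh.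
case: (leqP L 1) => hL1.
  have -> : L = 1 by lia.
  have hVS : V = S.
    apply/eqP; rewrite eqEsubset hSV andbT; apply/subsetP=> x /hh[k hk].
    have -> : k = 0 by lia.
    by rewrite expg0 perm1.
  by rewrite hVS /stateperm expg1 mulgV orbit_size1.
have V0 : 0 < #|V| by lia.
have hw := stateperm_Bn L hV hS.
case hall: [forall x in V, [exists k : 'I_L.-1, (csucc V ^+ k)%g x \in S]].
  have hh' : hits V S L.-1.
    move=> x hx; have /existsP[k hk] := implyP (forallP hall x) hx.
    by exists (nat_of_ord k).
  have hpi := piT_state hV hS hSV hS2 hL1 hLV hh'.
  rewrite orbit_sizeS //; last first.
    apply/eqP=> e; have [s hs] : exists s, s \in S by apply/card_gt0P; apply: leq_trans hS2.
    move: hpi; rewrite e piT1 => /permP/(_ (nthc V s 0)).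
    rewrite perm1 csucc_nthc // => /(nthc_eq s V0).
    by rewrite !modn_small; lia.
  rewrite (PopT_state hV hS hSV hS2 hL1 hLV hh') IHd //; lia.
move/negbT: hall => /forallPn[x]; rewrite negb_imply => /andP[hx /existsPn hno].
have [b hb1 hb] := nthc_surj x hx.
(* The predecessor of the missed window, reached by going almost once round to avoid subtraction.
   Its own window of length [L] must hit [S], which can only happen at itself. *)
have hx' : nthc V x (b + #|V|.-1) \in V by apply: nthc_in.
set b' := b + #|V|.-1 in hx'.
have hX k : nthc V x (b'.+1 + k) = nthc V x (b + k).
  have -> : b'.+1 + k = b + k + #|V| by rewrite /b'; lia.
  by rewrite nthcM.
have hnoS k : k < L.-1 -> nthc V x (b + k) \notin S.
  by move=> hk; have := hno (Ordinal hk); rewrite {1}hb csuccX_nthc.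
have hend : nthc V x (b + L.-1) \in S.
  have [k hk] := hh _ hx; rewrite {1}hb csuccX_nthc // => hkS.
  case: (ltnP k L.-1) => h; first by have := hnoS _ h; rewrite hkS.
  by have <- : k = L.-1 by lia.
set s := nthc V x b' in hx'.
have hsS : s \in S.
  have [[|k] hk] := hh _ hx'; first by rewrite expg0 perm1.
  rewrite /s csuccX_nthc // -addSnnS hX => hkS.
  by have := hnoS k; rewrite hkS => /(_ _); lia.
have hgap : csucc S s = (csucc V ^+ L)%g s.
  rewrite /s csuccX_nthc //; apply: csucc_first_return => //; try lia.
    have -> : b' + L = b'.+1 + L.-1 by lia.
    by rewrite hX.
  move=> j hj; have -> : j = b'.+1 + (j - b'.+1) by lia.
  by rewrite hX hnoS //; lia.
have [V' [S' [[h1 h2 h3 h4] [h5 h6 h7 <-]]]] := fillgap_pair hV hS hSV hS2 hL1 hLV hh hsS hgap.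
by apply: IHd => //; lia.
Qed.

End Orbits.

(** * Classification and counting *)

Section Classification.
Variable n : nat.
Notation pmn := (pm n).
Notation c := (coxc n).
Implicit Types (x y z s : pmn) (u v w t : {perm pmn}) (V S : {set pmn}).

(** A permutation crosses the level [z] upwards as often as downwards, and every downward crossing
    is a descent. *)
Lemma crossing_unique u z (k1 k2 : pmn) : (#|descents u| <= 1) ->
  k1 < z <= u k1 -> k2 < z <= u k2 -> k1 = k2.
Proof.
move=> hu h1 h2; pose A := [set k : pmn | k < z]; pose B := [set k : pmn | u k < z].
have hAB : #|A| = #|B|.
  rewrite -(card_imset B (@perm_inj _ u)); apply: eq_card => y.
  rewrite inE; apply/idP/imsetP => [h|[k]].
    by exists ((u^-1)%g y); rewrite ?inE permKV.
  by rewrite inE => h ->.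
have h3 : #|A :\: B| <= 1.
  apply: leq_trans (_ : #|B :\: A| <= 1).
    have h3 := cardsID B A; have h4 := cardsID A B; rewrite setIC in h4.
    suff -> : #|A :\: B| = #|B :\: A| by [].
    by apply/eqP; rewrite -(eqn_add2l #|A :&: B|) h3 h4 hAB.
  apply: leq_trans hu; apply: subset_leq_card; apply/subsetP=> k.
  by rewrite !inE -leqNgt => /andP[h3 h4]; apply: leq_trans h4 h3.
have hin (k : pmn) : k < z <= u k -> k \in A :\: B by rewrite !inE -leqNgt andbC.
by have := card_le1_eqP h3 _ _ (hin _ h2) (hin _ h1).
Qed.

Lemma one_descent u : #|descents u| = 1 -> u = csucc [set x | u x != x].
Proof.
move=> hu; have /cards1P[x0 hx0] : #|descents u| == 1 by rewrite hu.
have hd (k : pmn) : (u k < k) = (k == x0) by have := in_set1 k x0; rewrite -hx0 inE.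
have hx : u x0 < x0 by rewrite hd.
have hu1 : #|descents u| <= 1 by rewrite hu.
apply/permP=> x; apply/esym; case hxS: (u x != x); last first.
  by rewrite csucc_out ?inE ?hxS //; move/negbFE/eqP: hxS.
have neqv (a b : pmn) : a != b -> a <> b :> nat.
  by move=> h /ord_inj e; rewrite e eqxx in h.
apply: csucc_eq; rewrite ?inE ?(inj_eq perm_inj) // => z; rewrite inE => hz.
rewrite leqNgt; apply/negP=> hlt.
have hup y : u y != y -> y != x0 -> y < u y.
  by move=> h1 h2; have := hd y; rewrite (negPf h2); have := neqv _ _ h1; lia.
have hsp := cdist_spec x z; have hsp' := cdist_spec x (u x).
case: (eqVneq x x0) => [e|hxx0]; last first.
  have hxu := hup _ hxS hxx0.
  have [hz1 hz2] : x < z /\ z < u x by have := ltn_ord z; have := ltn_ord (u x); lia.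
  pose k := (u^-1)%g z; have hk : u k = z by rewrite permKV.
  (* If the preimage [k] of [z] is below [z], then [k] and [x] both cross the level [z]. Otherwise
     [k] is the descent, [z] moves up, and [z] and [x] both cross the level [z + 1]. *)
  have hkz : k <> z :> nat.
    by move=> /ord_inj e; move: hz; rewrite -{1}e hk eqxx.
  case: (ltngtP k z) => // hkz'.
    have ek : k = x by apply: (@crossing_unique u z) => //; rewrite ?hk; lia.
    by move: hk; rewrite ek => e; rewrite e ltnn in hz2.
  have ek : k = x0 by apply/eqP; rewrite -hd hk.
  have hzx0 : z != x0 by apply/eqP=> e; case: hkz; rewrite ek e.
  have hzu := hup _ hz hzx0.
  have hzu' : u z < n.*2 by exact: ltn_ord.
  have hlt1 : z.+1 < n.*2 by lia.
  have exz : x = z.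
    by apply: (@crossing_unique u (Ordinal hlt1)) => //=; lia.
  by rewrite exz ltnn in hz1.
rewrite e in hsp hsp' hlt.
(* At the descent [x0], everything below [u x0] or above [x0] is fixed, so [u x0] is the least moved
   point and [x0] the greatest. *)
have low : forall (d : nat) y, y = d :> nat -> y < u x0 -> u y = y.
  move=> d; elim/ltn_ind: d => d IHd y hy hyx; apply/eqP/negPn/negP=> hny.
  pose k := (u^-1)%g y; have hk : u k = y by rewrite permKV.
  have hky : k <> y :> nat by move=> /ord_inj e1; move: hny; rewrite -{1}e1 hk eqxx.
  have hkk : k < y.
    case: (ltngtP k y) => // h; have : k == x0 by rewrite -hd hk.
    by move/eqP=> e1; move: hyx; rewrite -e1 hk ltnn.
  have h : u k = k by apply: (IHd (nat_of_ord k)) => //; lia.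
  by apply: hky; rewrite -hk h.
have high : forall (d : nat) y, n.*2 - y = d -> x0 < y -> u y = y.
  move=> d; elim/ltn_ind: d => d IHd y hy hyx; apply/eqP/negPn/negP=> hny.
  have hyx0 : y != x0 by apply: contraTneq hyx => ->; rewrite ltnn.
  have hyu := hup _ hny hyx0; have hlt1 := ltn_ord (u y).
  have h : u (u y) = u y by apply: (IHd (n.*2 - u y)) => //; lia.
  by move/perm_inj: h => h; rewrite h eqxx in hny.
have := ltn_ord z; have := ltn_ord x0 => h1 h2.
case: (ltnP z (u x0)) => h3; first by rewrite (low z z) ?eqxx in hz.
case: (ltnP x0 z) => h4; first by rewrite (high (n.*2 - z) z) ?eqxx in hz.
lia.
Qed.

Lemma coxcV_expg : 0 < n -> (c^-1)%g = (c ^+ n.*2.-1)%g.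
Proof.
move=> hn; apply/permP=> x; apply: (@perm_inj _ c); rewrite permKV.
have V0 : 0 < #|[set: pmn]| by rewrite cardsT card_ord; lia.
have [b _ hb] := nthc_surj x (in_setT x).
rewrite -permM -expgSr prednK; last lia.
rewrite {2}hb -csuccT csuccX_nthc //.
have e : #|[set: pmn]| = n.*2 by rewrite cardsT card_ord.
by rewrite -[in X in b + X]e nthcM // -hb.
Qed.

Definition kreweras w : {perm pmn} := comp (c^-1)%g (w^-1)%g.

Lemma kreweras_Bn w : w \in Bn n -> kreweras w \in Bn n.
Proof. by move=> hw; rewrite BnM ?BnV ?Bn_coxc. Qed.

(** [kreweras w] sends [w z] to the predecessor of [z]. For [z] other than [0] this descends iff [z]
    is not a descent of [w]; for [z = 0] neither is a descent. *)
Lemma card_descents_kreweras w : 0 < n -> #|descents (kreweras w)| + #|descents w| = n.*2.-1.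
Proof.
move=> hn; have h0 : 0 < n.*2 by lia.
pose z0 : pmn := Ordinal h0.
have hz0 : z0 \notin descents w by rewrite inE.
have e1 : #|descents (kreweras w)| = #|~: (z0 |: descents w)|.
  rewrite -(card_imset (~: _) (@perm_inj _ w)); apply: eq_card => y.
  have hh z : (((c^-1)%g z) < w z) = (z \in ~: (z0 |: descents w)).
    rewrite !inE negb_or -leqNgt -(inj_eq (@ord_inj _)) /=.
    have := coxcV_val z; have := ltn_ord (w z); have := ltn_ord ((c^-1)%g z); lia.
  rewrite inE compE; apply/idP/imsetP => [h|[z hz ->]].
    by exists ((w^-1)%g y); rewrite ?permKV // -hh permKV.
  by rewrite permK hh.
have := cardsC (z0 |: descents w); rewrite cardsU1 hz0 card_ord -e1 => h.
by rewrite -[in RHS]h add1n addSn addnC.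
Qed.

Lemma stateperm_kreweras w S : 0 < n -> kreweras w = csucc S ->
  w = stateperm setT S n.*2.-1.
Proof.
move=> hn h; rewrite /stateperm csuccT -coxcV_expg // -h.
by rewrite /kreweras /comp invMg !invgK mulgA mulVg mul1g.
Qed.

Lemma csucc_neq S x : 1 < #|S| -> (csucc S x != x) = (x \in S).
Proof.
move=> hS; case hx: (x \in S); last by rewrite csucc_out ?hx // eqxx.
have : 0 < #|S :\ x| by rewrite (cardsD1 x S) hx in hS.
case/card_gt0P=> z; rewrite !inE => /andP[hzx hz].
apply/eqP=> e; have := csucc_min hx hz; rewrite e.
have hzx' : z <> x :> nat by move/ord_inj=> e1; rewrite e1 eqxx in hzx.
have := cdist_spec x x; have := cdist_spec x z; have := ltn_ord z; lia.
Qed.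

Lemma descents_class w : 0 < n -> w \in Bn n -> #|descents w| = n.*2 - 2 ->
  exists S, [/\ negclosed S, 1 < #|S| & w = stateperm setT S n.*2.-1].
Proof.
move=> hn hw hd; have hk := card_descents_kreweras w hn.
have hu : #|descents (kreweras w)| = 1 by lia.
have e := one_descent hu; exists [set x | kreweras w x != x]; split.
- move=> x; rewrite !inE; have /BnP -> := kreweras_Bn hw.
  by rewrite (inj_eq (inv_inj (@negIK n))).
- have : 0 < #|descents (kreweras w)| by rewrite hu.
  case/card_gt0P=> x; rewrite inE => hx; apply/card_gt1P.
  have hx' : kreweras w x != x by apply: contraTneq hx => ->; rewrite ltnn.
  by exists x, (kreweras w x); rewrite !inE (inj_eq perm_inj) hx' eq_sym hx'.
exact: stateperm_kreweras.
Qed.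

(** A window of [2n - 1] points omits a single point, and [S] has two. *)
Lemma hitsT S : 0 < n -> 1 < #|S| -> hits setT S n.*2.-1.
Proof.
move=> hn hS x _; have e : #|[set: pmn]| = n.*2 by rewrite cardsT card_ord.
have V0 : 0 < #|[set: pmn]| by rewrite e; lia.
have [b _ hb] := nthc_surj x (in_setT x).
pose y := nthc setT x (b + n.*2.-1).
have [z hz hzy] : exists2 z, z \in S & z != y.
  have : 0 < #|S :\ y| by move: hS; rewrite (cardsD1 y S); case: (y \in S) => // /ltnW.
  by case/card_gt0P=> z; rewrite !inE => /andP[h1 h2]; exists z.
have [d [hd1 hd2 hzd]] := nthc_after x V0 b (in_setT z).
case: (ltngtP d n.*2.-1) => h.
- by exists d => //; rewrite {1}hb csuccX_nthc // -hzd.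
- exists 0; first lia.
  have ed : d = #|[set: pmn]| by lia.
  by rewrite expg0 perm1 hb -(nthcM _ x b) -ed -hzd.
by case/eqP: hzy; rewrite hzd h.
Qed.

Lemma negclosedT : negclosed [set: pmn]. Proof. by move=> x; rewrite !inE. Qed.

Lemma orbit_size_stateT S : 1 < n -> negclosed S -> 2 < #|S| ->
  orbit_size (stateperm setT S n.*2.-1) = n.*2.-1.
Proof.
move=> hn hS hS2; apply: orbit_size_state => //; first exact: negclosedT.
- lia.
- by rewrite cardsT card_ord; lia.
by apply: hitsT; lia.
Qed.

(** Here [w] is the inverse of [c] and [piT w = c], so one step gives the state with [V] and [S]
    both full and [L = 2n - 1]. *)
Lemma orbit_size_max w : 1 < n -> w \in Bn n -> #|descents w| = n.*2.-1 ->
  orbit_size w = n.*2.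
Proof.
move=> hn hw hd; have hn0 : 0 < n by lia.
have hk := card_descents_kreweras w hn0.
have /permP hu : kreweras w = 1%g by apply: descents_eq0; lia.
have ew : w = (c^-1)%g.
  apply/permP=> x; have := hu (w x); rewrite perm1 compE permK => ->.
  by [].
have e : #|[set: pmn]| = n.*2 by rewrite cardsT card_ord.
have V0 : 0 < #|[set: pmn]| by rewrite e; lia.
have hpi : piT w = c.
  rewrite piTE // -csuccT; apply: ncperm_csucc => x y; rewrite !inE orbT.
  have H := ncclosure_nc w; have [k _ ->] := nthc_surj x (in_setT y).
  have [b _ hb] := nthc_surj x (in_setT x).
  have hstep z : ncclosure w z (c z).
    rewrite (nc_sym H); have := ncclosure_perm w (c z).
    by rewrite {2}ew permK.
  have h0 j : ncclosure w (nthc setT x 0) (nthc setT x j).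
    elim: j => [|j IHj]; first exact: nc_refl H _.
    by rewrite -csucc_nthc // csuccT; apply: (nc_trans H) IHj (hstep _).
  by rewrite {1}hb; apply: (nc_trans H) (h0 k); rewrite (nc_sym H).
have w1 : w != 1%g.
  apply/eqP=> e1; move: hd; rewrite e1; have -> : descents (1%g : {perm pmn}) = set0.
    by apply/setP=> x; rewrite !inE perm1 ltnn.
  by rewrite cards0; lia.
rewrite orbit_sizeS //.
have -> : PopT w = stateperm setT setT n.*2.-1.
  by rewrite /PopT hpi {1}ew /comp /stateperm csuccT -coxcV_expg.
by rewrite orbit_size_stateT ?e //; [lia|exact: negclosedT|lia].
Qed.

(* With [S = {s, -s}] the two half-circles cut out by [s] and [-s] are invariant. *)
Lemma two_gaps_not_cyclic S w : 0 < n -> negclosed S -> #|S| = 2 ->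
  w \in Bn n -> w = stateperm setT S n.*2.-1 -> #|descents (piT w)| <> 1.
Proof.
move=> hn hS hS2 hw ew hd.
have [s hs hsn] : exists2 s, s \in S & s < n.
  have : 0 < #|S| by lia.
  case/card_gt0P=> s hs; case: (ltnP s n) => h; first by exists s.
  by exists (negI s); rewrite ?hS //; have := negI_val s; have := ltn_ord s; lia.
have hSE x : (x \in S) = (x == s) || (x == negI s).
  have : [set s; negI s] == S.
    rewrite eqEcard cards2 hS2 eq_sym negI_neq leqnn andbT.
    by apply/subsetP=> y /set2P[->|->]; rewrite ?hS.
  by move/eqP=> <-; rewrite !inE.
have cs : csucc S s = negI s.
  have h : csucc S s != s by rewrite csucc_neq ?hs // hS2.
  have := csucc_in hs; rewrite hSE (negPf h) /= => /eqP //.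
have cns : csucc S (negI s) = s by have /BnP -> := csucc_Bn hS; rewrite cs negIK.
pose A x := (s < x <= s + n).
have hAn x : A (negI x) = ~~ A x.
  by rewrite /A; have := negI_val x; have := ltn_ord x; lia.
pose r : rel pmn := fun x y => A x == A y.
have H : ncrel r.
  split; rewrite /r.
  - by move=> x.
  - by move=> x y; rewrite eq_sym.
  - by move=> y x z /eqP-> /eqP->.
  - by move=> x y /eqP e; rewrite !hAn e.
  by move=> i j k l h1 h2 h3 /eqP h4 /eqP h5; rewrite /A in h4 h5 *; lia.
have hrw x : r x (w x).
  have hwx : csucc S (w x) = (c^-1)%g x by rewrite ew statepermE csuccT -coxcV_expg.
  have hx := coxcV_val x; have hns := negI_val s.
  rewrite /r /A; case hu: ((c^-1)%g x \in S); last first.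
    have -> : w x = (c^-1)%g x by apply: (@perm_inj _ (csucc S)); rewrite hwx csucc_out ?hu.
    have h1 : (c^-1)%g x <> s :> nat by move/ord_inj=> e; rewrite e hs in hu.
    have h2 : (c^-1)%g x <> negI s :> nat by move/ord_inj=> e; rewrite e hS hs in hu.
    by have := ltn_ord x; have := ltn_ord ((c^-1)%g x); lia.
  move: hu; rewrite hSE => /orP[/eqP e|/eqP e]; rewrite e in hx hwx.
    have -> : w x = negI s by apply: (@perm_inj _ (csucc S)); rewrite hwx cns.
    lia.
  have -> : w x = s by apply: (@perm_inj _ (csucc S)); rewrite hwx cs.
  by have := ltn_ord x; lia.
have hrp x : r x (piT w x) by apply: (ncclosure_min H hrw); apply: piT_rel.
(* A single descent makes [piT w] a cycle on a symmetric set. It would join a point to its antipode,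
   which lies in the other half-circle. *)
have e := one_descent hd; set S' := [set x | _] in e.
have hS' : negclosed S'.
  move=> x; rewrite !inE; have /BnP -> := piT_Bn hw.
  by rewrite (inj_eq (inv_inj (@negIK n))).
have [y] : exists y, y \in descents (piT w) by apply/card_gt0P; rewrite hd.
rewrite inE => hy.
have hyS : y \in S' by rewrite inE; apply: contraTneq hy => ->; rewrite ltnn.
have V0 : 0 < #|S'| by apply/card_gt0P; exists y.
have [m [_ hneg]] := nthc_neg y V0 hS'.
have hr0 k : r (nthc S' y 0) (nthc S' y k).
  elim: k => [|k IHk]; first exact: nc_refl H _.
  by rewrite -csucc_nthc // -e; apply: (nc_trans H) IHk (hrp _).
have := hr0 (0 + m); rewrite -hneg /r hAn.
by case: (A _).
Qed.

Lemma splittable_class w : 1 < n -> Bsplittable w ->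
  exists S, [/\ negclosed S, 2 < #|S| & w = stateperm setT S n.*2.-1].
Proof.
move=> hn /and3P[hw]; rewrite card_antiexc => /eqP hd; rewrite cyc_piT // => /eqP hc.
have hn0 : 0 < n by lia.
have [S [h1 h2 h3]] := descents_class hn0 hw hd; exists S; split=> //.
case: (ltngtP 2 #|S|) => // h; first lia.
by case: (two_gaps_not_cyclic hn0 h1 (esym h) hw h3 hc).
Qed.

Lemma orbit_size_splittable w : 1 < n -> w \in Bn n ->
  (orbit_size w == n.*2 - 1) = Bsplittable w.
Proof.
move=> hn hw; apply/eqP/idP => [ho|hs]; last first.
  have [S [h1 h2 ->]] := splittable_class hn hs.
  by rewrite orbit_size_stateT // subn1.
have hn0 : 0 < n by lia.
have hle := orbit_size_le hw; have hk := card_descents_kreweras w hn0.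
(* The orbit bound gives at least [2n - 2] descents, [card_descents_kreweras] at most [2n - 1], and
   [orbit_size_max] excludes the latter. *)
have hd : #|descents w| = n.*2 - 2.
  case: (eqVneq #|descents w| n.*2.-1) => h; last by move/eqP: h; lia.
  by have := orbit_size_max hn hw h; lia.
have w1 : w != 1%g.
  by apply/eqP=> e; move: ho; rewrite e orbit_size1; lia.
have hp := descents_PopT hw; have hp1 := piT_neq1 hw w1.
have hle' := orbit_size_le (PopT_Bn hw); rewrite orbit_sizeS // in ho.
have hpi : #|descents (piT w)| = 1 by lia.
by rewrite /Bsplittable hw card_antiexc hd eqxx cyc_piT // hpi.
Qed.

End Classification.

(** * Counting symmetric sets by their lower halves *)

Section Counting.
Variable n : nat.
Notation pmn := (pm n).
Implicit Types (x y : pmn) (S : {set pmn}) (T : {set 'I_n}).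

Lemma lo_subproof (i : 'I_n) : i < n.*2. Proof. by have := ltn_ord i; lia. Qed.
Definition lo (i : 'I_n) : pmn := Ordinal (lo_subproof i).

Lemma lo_inj : injective lo. Proof. by move=> i j [] /ord_inj. Qed.

Definition symset T : {set pmn} := lo @: T :|: [set negI (lo i) | i in T].

Lemma lo_neq_neg (i j : 'I_n) : lo i != negI (lo j).
Proof.
apply/eqP=> /(congr1 (@nat_of_ord _)); have := negI_val (lo j).
have := ltn_ord i; have := ltn_ord j; rewrite /=; lia.
Qed.

Lemma lo_symset T i : (lo i \in symset T) = (i \in T).
Proof.
rewrite in_setU mem_imset; last exact: lo_inj.
case: (i \in T) => //=; apply/imsetP=> -[j _ /eqP]; apply/negP; exact: lo_neq_neg.
Qed.

Lemma negI_lo_symset T i : (negI (lo i) \in symset T) = (i \in T).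
Proof.
rewrite in_setU orbC (mem_imset (f := fun i => negI (lo i))); last by move=> a b /(inv_inj (@negIK n)) /lo_inj.
case: (i \in T) => //=; apply/imsetP=> -[j _ /eqP]; rewrite eq_sym.
by apply/negP; apply: lo_neq_neg.
Qed.

Lemma pm_lo x : exists i, x = lo i \/ x = negI (lo i).
Proof.
have h := negI_val x; have hx := ltn_ord x.
case: (ltnP x n) => hn; first by exists (Ordinal hn); left; apply: ord_inj.
have hn' : negI x < n by lia.
by exists (Ordinal hn'); right; apply: (inv_inj (@negIK n)); rewrite negIK; apply: ord_inj.
Qed.

Lemma symset_negclosed T : negclosed (symset T).
Proof.
by move=> x; have [i [->|->]] := pm_lo x; rewrite ?negIK !(lo_symset, negI_lo_symset).
Qed.

Lemma symset_inj : injective symset.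
Proof. by move=> T T' e; apply/setP=> i; rewrite -lo_symset e lo_symset. Qed.

Lemma card_symset T : #|symset T| = #|T|.*2.
Proof.
rewrite cardsU disjoint_setI0 ?cards0 ?subn0.
  rewrite !card_imset ?addnn //; first by move=> a b /(inv_inj (@negIK n)) /lo_inj.
  exact: lo_inj.
rewrite -setI_eq0; apply/eqP/setP=> x; rewrite !inE; apply/negP=> /andP[].
by case/imsetP=> i _ -> /imsetP[j _ /eqP]; apply/negP/lo_neq_neg.
Qed.

Lemma symset_surj S : negclosed S -> S = symset [set i | lo i \in S].
Proof.
move=> hS; apply/setP=> x.
by have [i [->|->]] := pm_lo x; rewrite ?hS ?lo_symset ?negI_lo_symset inE.
Qed.

Lemma card_gt1_sets : #|[set T : {set 'I_n} | 1 < #|T|]| = 2 ^ n - n - 1.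
Proof.
have hk k : #|[set T : {set 'I_n} | #|T| == k]| = 'C(n, k).
  by rewrite card_draws card_ord.
have := cardsC [set T : {set 'I_n} | 1 < #|T|].
rewrite -cardsT -powersetT card_powerset cardsT card_ord => <-.
have -> : ~: [set T : {set 'I_n} | 1 < #|T|] =
    [set T : {set 'I_n} | #|T| == 1] :|: [set T : {set 'I_n} | #|T| == 0].
  by apply/setP=> T; rewrite !inE; lia.
rewrite cardsU disjoint_setI0 ?cards0; first by rewrite !hk bin1 bin0; lia.
by rewrite -setI_eq0; apply/eqP/setP=> T; rewrite !inE; lia.
Qed.

Lemma card_max_orbits : 1 < n ->
  #|[set w in Bn n | orbit_size w == n.*2 - 1]| = 2 ^ n - n - 1.
Proof.
move=> hn; rewrite -card_gt1_sets.
rewrite -(card_in_imset (f := fun T => stateperm setT (symset T) n.*2.-1)); last first.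
  (* With more than one element, a set is recovered as the support of its cyclic successor. *)
  move=> T T'; rewrite !inE => hT hT' /mulgI /invg_inj e; apply: symset_inj.
  have hc (U : {set 'I_n}) : 1 < #|U| -> 1 < #|symset U| by rewrite card_symset; lia.
  by apply/setP=> x; rewrite -!csucc_neq ?hc // e.
apply: eq_card => w; rewrite inE; apply/andP/imsetP => [[hw]|[T]].
  rewrite orbit_size_splittable // => /(splittable_class hn)[S [h1 h2 ->]].
  have e := symset_surj h1; exists [set i | lo i \in S]; last by rewrite -e.
  by rewrite inE; have := card_symset [set i | lo i \in S]; rewrite -e; lia.
rewrite inE => hT ->; have h2 : 2 < #|symset T| by rewrite card_symset; lia.
have hT' := symset_negclosed T; split.
  by apply: stateperm_Bn => //; apply: negclosedT.
by rewrite orbit_size_stateT // subn1.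
Qed.

End Counting.

Theorem mainTheorem4 (n : nat) (hn : 2 <= n) :
  (forall w : {perm 'I_(n.*2)}, w \in Bn n ->
     (orbit_size w == n.*2 - 1) = Bsplittable w) /\
  #|[set w in Bn n | orbit_size w == n.*2 - 1]| = 2 ^ n - n - 1.
Proof.
split; last exact: card_max_orbits.
by move=> w; apply: orbit_size_splittable.
Qed.
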